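(* Let $X$ be a connected, locally path connected Polish space (separable and completely metrizable). Then $\pi_1(X)$ is either countable or of cardinality continuum, and $H_1(X)$ is either countable or of cardinality continuum. *)

(* Defs.v *)
From Stdlib Require Import Reals Lra ZArith List Classical ClassicalEpsilon.
Open Scope R_scope.

Definition is_metric {X : Type} (d : X -> X -> R) : Prop :=
  (forall x y, 0 <= d x y) /\
  (forall x y, d x y = 0 <-> x = y) /\
  (forall x y, d x y = d y x) /\
  (forall x y z, d x z <= d x y + d y z).

Definition cauchy_seq {X : Type} (d : X -> X -> R) (u : nat -> X) : Prop :=
  forall eps, 0 < eps -> exists N : nat, forall m n, (N <= m)%nat -> (N <= n)%nat ->
    d (u m) (u n) < eps.

Definition complete {X : Type} (d : X -> X -> R) : Prop :=
  forall u : nat -> X, cauchy_seq d u ->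
    exists l, forall eps, 0 < eps -> exists N : nat, forall n, (N <= n)%nat -> d (u n) l < eps.

Definition separable {X : Type} (d : X -> X -> R) : Prop :=
  exists s : nat -> X, forall x eps, 0 < eps -> exists n, d x (s n) < eps.

Definition is_open {X : Type} (d : X -> X -> R) (U : X -> Prop) : Prop :=
  forall x, U x -> exists eps, 0 < eps /\ forall y, d x y < eps -> U y.

Definition connected {X : Type} (d : X -> X -> R) : Prop :=
  (exists x : X, True) /\
  forall U V, is_open d U -> is_open d V ->
    (forall x, U x \/ V x) -> (forall x, ~ (U x /\ V x)) ->
    (forall x, ~ U x) \/ (forall x, ~ V x).

Definition I01 : Type := { t : R | 0 <= t <= 1 }.
Definition D2 : Type := { p : R * R | 0 <= fst p /\ 0 <= snd p /\ fst p + snd p <= 1 }.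

Lemma i0_pf : 0 <= 0 <= 1. Proof. lra. Qed.
Lemma i1_pf : 0 <= 1 <= 1. Proof. lra. Qed.
Definition i0 : I01 := exist _ 0 i0_pf.
Definition i1 : I01 := exist _ 1 i1_pf.

Lemma f0_pf (t : I01) :
  0 <= fst (1 - proj1_sig t, proj1_sig t) /\ 0 <= snd (1 - proj1_sig t, proj1_sig t)
  /\ fst (1 - proj1_sig t, proj1_sig t) + snd (1 - proj1_sig t, proj1_sig t) <= 1.
Proof. destruct t as [t Ht]; simpl; lra. Qed.
Lemma f1_pf (t : I01) :
  0 <= fst (0, proj1_sig t) /\ 0 <= snd (0, proj1_sig t)
  /\ fst (0, proj1_sig t) + snd (0, proj1_sig t) <= 1.
Proof. destruct t as [t Ht]; simpl; lra. Qed.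
Lemma f2_pf (t : I01) :
  0 <= fst (proj1_sig t, 0) /\ 0 <= snd (proj1_sig t, 0)
  /\ fst (proj1_sig t, 0) + snd (proj1_sig t, 0) <= 1.
Proof. destruct t as [t Ht]; simpl; lra. Qed.

(* Affine face maps Delta^1 -> Delta^2 with vertices e0=(0,0), e1=(1,0), e2=(0,1):
   face i omits vertex e_i and preserves vertex order. *)
Definition face0_map (t : I01) : D2 := exist _ (1 - proj1_sig t, proj1_sig t) (f0_pf t).
Definition face1_map (t : I01) : D2 := exist _ (0, proj1_sig t) (f1_pf t).
Definition face2_map (t : I01) : D2 := exist _ (proj1_sig t, 0) (f2_pf t).

Definition cont1 {X : Type} (d : X -> X -> R) (g : I01 -> X) : Prop :=
  forall t eps, 0 < eps -> exists delta, 0 < delta /\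
    forall s : I01, Rabs (proj1_sig s - proj1_sig t) < delta -> d (g s) (g t) < eps.

Definition cont2 {X : Type} (d : X -> X -> R) (g : D2 -> X) : Prop :=
  forall p eps, 0 < eps -> exists delta, 0 < delta /\
    forall q : D2, Rabs (fst (proj1_sig q) - fst (proj1_sig p))
                   + Rabs (snd (proj1_sig q) - snd (proj1_sig p)) < delta ->
                   d (g q) (g p) < eps.

Definition cont_sq {X : Type} (d : X -> X -> R) (H : I01 -> I01 -> X) : Prop :=
  forall s t eps, 0 < eps -> exists delta, 0 < delta /\
    forall s' t' : I01, Rabs (proj1_sig s' - proj1_sig s) + Rabs (proj1_sig t' - proj1_sig t) < delta ->
      d (H s' t') (H s t) < eps.

Definition path_connected_set {X : Type} (d : X -> X -> R) (V : X -> Prop) : Prop :=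
  forall x y, V x -> V y -> exists g : I01 -> X,
    cont1 d g /\ g i0 = x /\ g i1 = y /\ forall t, V (g t).

Definition locally_path_connected {X : Type} (d : X -> X -> R) : Prop :=
  forall x U, is_open d U -> U x ->
    exists V, is_open d V /\ V x /\ (forall y, V y -> U y) /\ path_connected_set d V.

Definition is_loop {X : Type} (d : X -> X -> R) (x0 : X) (g : I01 -> X) : Prop :=
  cont1 d g /\ g i0 = x0 /\ g i1 = x0.

Definition loop_homotopic {X : Type} (d : X -> X -> R) (x0 : X) (g h : I01 -> X) : Prop :=
  exists H : I01 -> I01 -> X, cont_sq d H /\
    (forall s, H s i0 = g s) /\ (forall s, H s i1 = h s) /\
    (forall t, H i0 t = x0 /\ H i1 t = x0).

Definition ind (P : Prop) : Z :=
  if excluded_middle_informative P then 1%Z else 0%Z.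

Definition sumZ (l : list Z) : Z := fold_right Z.add 0%Z l.

(* singular 1-chains: finitely supported Z-valued functions on maps Delta^1 -> X,
   supported on continuous maps (the singular 1-simplices) *)
Definition chain1_on {X : Type} (d : X -> X -> R) (c : (I01 -> X) -> Z)
  (L : list (I01 -> X)) : Prop :=
  NoDup L /\ forall s, c s <> 0%Z -> In s L /\ cont1 d s.

Definition chain2_on {X : Type} (d : X -> X -> R) (b : (D2 -> X) -> Z)
  (L : list (D2 -> X)) : Prop :=
  NoDup L /\ forall s, b s <> 0%Z -> In s L /\ cont2 d s.

Definition is_cycle {X : Type} (d : X -> X -> R) (c : (I01 -> X) -> Z) : Prop :=
  exists L, chain1_on d c L /\
    forall x : X,
      sumZ (map (fun s => (c s * (ind (s i1 = x) - ind (s i0 = x)))%Z) L) = 0%Z.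

Definition is_boundary1 {X : Type} (d : X -> X -> R) (c : (I01 -> X) -> Z) : Prop :=
  exists (b : (D2 -> X) -> Z) (L : list (D2 -> X)), chain2_on d b L /\
    forall s : I01 -> X,
      c s = sumZ (map (fun tau =>
              (b tau * (ind ((fun t => tau (face0_map t)) = s)
                      - ind ((fun t => tau (face1_map t)) = s)
                      + ind ((fun t => tau (face2_map t)) = s)))%Z) L).

Definition homologous {X : Type} (d : X -> X -> R) (c c' : (I01 -> X) -> Z) : Prop :=
  is_boundary1 d (fun s => (c s - c' s)%Z).

Definition countable_quotient {A : Type} (P : A -> Prop) (E : A -> A -> Prop) : Prop :=
  exists f : nat -> A, (forall n, P (f n)) /\ forall a, P a -> exists n, E a (f n).

Definition continuum_quotient {A : Type} (P : A -> Prop) (E : A -> A -> Prop) : Prop :=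
  exists phi : A -> R,
    (forall a b, P a -> P b -> (phi a = phi b <-> E a b)) /\
    (forall r, exists a, P a /\ phi a = r).

(* Main.v *)
(** If small loops are locally trivial (up to homotopy, resp. homology), then by Lebesgue numbers every
    loop is equivalent to a word in a countable family of short paths between points of a countable dense
    set, and there are countably many classes.  Otherwise, at some point [x] there are nontrivial loops
    [f 0], [f 1], ... converging to [x].  Concatenating those with [a n = true] gives a loop [G a] for every
    [a] in the Cantor space, and [E a b := G a ~ G b] is an analytic equivalence relation for which
    [a] and [b] are inequivalent whenever they differ in exactly one coordinate.  If [E] were nonmeager, it
    would be comeager in some basic open set, hence hold for both [(a, b)] and [(a, b')], with [b'] obtained
    from a generic [b] by changing one coordinate; this is a contradiction.  So [E] is meager, and Mycielski's
    theorem gives a perfect set of inequivalent points.  Homology is reduced to loops at a base point, since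
    every 1-cycle of a path connected space is homologous to such a loop. *)

From Stdlib Require Import Reals Lra Lia ZArith List Classical ClassicalEpsilon.
From Stdlib Require Import FunctionalExtensionality PropExtensionality Cantor.
From Stdlib Require Import Setoid Morphisms Permutation.
From Coquelicot Require Import Compactness Continuity.
Require Import Defs.
Open Scope R_scope.

(** * Countable types and the continuum *)

(** Cardinality continuum means a bijection between the classes and the reals. Besides perfectly
    many inequivalent points this takes an injection of the classes into the Cantor space: a loop is
    coded by the balls around a dense sequence that contain its values at rational times, and the
    two injections are combined by a Cantor-Schroeder-Bernstein argument. Homotopy and homology are
    treated at once, as congruences on paths with fixed ends that contain homotopy; analyticity is
    checked separately for each. This is the delicate point for homology: the equation between a
    chain and a boundary involves cancellations between faces, whose pattern may vary along a
    sequence. It is replaced by an explicit matching of the faces of finitely many triangles; the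
    matching is discrete data, and for a fixed matching the equations survive uniform limits.
    Analyticity enters only through families of witnesses covered, at each level, by countably many
    small pieces, and the Baire property is proved directly for the resulting Souslin scheme. *)

Lemma functional_choice {A B : Type} (T : A -> B -> Prop) :
  (forall a, exists b, T a b) -> exists f, forall a, T a (f a).
Proof.
  intros H. exists (fun a => proj1_sig (constructive_indefinite_description _ (H a))).
  intros a. exact (proj2_sig (constructive_indefinite_description _ (H a))).
Qed.

Definition countable (A : Type) : Prop :=
  exists f : nat -> A, forall a, exists n, f n = a.

Lemma countable_nat : countable nat.
Proof. exists (fun n => n). intros a; exists a; reflexivity. Qed.

Lemma countable_bool : countable bool.
Proof. exists (fun n => Nat.eqb n 0). intros []; [exists 0%nat | exists 1%nat]; reflexivity. Qed.

Lemma countable_prod A B : countable A -> countable B -> countable (A * B).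
Proof.
  intros [f Hf] [g Hg].
  exists (fun n => let (i, j) := Cantor.of_nat n in (f i, g j)).
  intros [a b]. destruct (Hf a) as [i Hi], (Hg b) as [j Hj].
  exists (Cantor.to_nat (i, j)). rewrite Cantor.cancel_of_to. congruence.
Qed.

Lemma countable_list A : countable A -> countable (list A).
Proof.
  intros [f Hf].
  set (F := fix F k n := match k with
    | O => nil
    | S k => let (i, j) := Cantor.of_nat n in f i :: F k j end).
  exists (fun n => let (k, j) := Cantor.of_nat n in F k j).
  assert (H : forall l, exists j, F (length l) j = l).
  { induction l as [|a l [j Hj]]; [exists 0%nat; reflexivity|].
    destruct (Hf a) as [i Hi]. exists (Cantor.to_nat (i, j)).
    cbn [length F]. rewrite Cantor.cancel_of_to. congruence. }
  intros l. destruct (H l) as [j Hj]. exists (Cantor.to_nat (length l, j)).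
  rewrite Cantor.cancel_of_to. exact Hj.
Qed.

(** Base 3 with digits 0 and 1: everything after place [n] adds at most half of [(/ 3) ^ n], so the
    first differing digit decides the order and the limit is injective. *)
Fixpoint cantor_sum (a : nat -> bool) (n : nat) : R :=
  match n with
  | O => 0
  | S n => cantor_sum a n + (if a n then (/ 3) ^ n else 0)
  end.

Lemma cantor_sum_mono a n m : (n <= m)%nat -> cantor_sum a n <= cantor_sum a m.
Proof.
  induction 1 as [|m _ IH]; [lra|]. simpl.
  assert (0 < (/ 3) ^ m) by (apply pow_lt; lra). destruct (a m); lra.
Qed.

Lemma cantor_sum_tail a n m : (n <= m)%nat ->
  cantor_sum a m <= cantor_sum a n + 3 / 2 * (/ 3) ^ n - 3 / 2 * (/ 3) ^ m.
Proof.
  induction 1 as [|m _ IH]; [lra|]. simpl.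
  assert (0 < (/ 3) ^ m) by (apply pow_lt; lra). destruct (a m); lra.
Qed.

Lemma cantor_sum_ext a b n : (forall i, (i < n)%nat -> a i = b i) -> cantor_sum a n = cantor_sum b n.
Proof.
  induction n as [|n IH]; intros H; [reflexivity|]. simpl.
  rewrite IH by (intros i Hi; apply H; lia). rewrite (H n) by lia. reflexivity.
Qed.

Lemma cantor_sum_lub a : { l | is_lub (fun r => exists n, r = cantor_sum a n) l }.
Proof.
  apply completeness.
  - exists (3 / 2). intros r [n ->].
    pose proof (cantor_sum_tail a 0 n (Nat.le_0_l n)). simpl in H.
    assert (0 < (/ 3) ^ n) by (apply pow_lt; lra). lra.
  - exists 0, 0%nat. reflexivity.
Qed.

Definition cantor_real (a : nat -> bool) : R := proj1_sig (cantor_sum_lub a).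

Lemma first_difference (a b : nat -> bool) : a <> b ->
  exists n, a n <> b n /\ forall i, (i < n)%nat -> a i = b i.
Proof.
  intros H. apply NNPP. intros Hn. apply H. extensionality i.
  induction i as [i IH] using (well_founded_induction lt_wf).
  destruct (Bool.bool_dec (a i) (b i)) as [e|ne]; [exact e|]. exfalso; eauto.
Qed.

Lemma cantor_real_lt a b n : a n = true -> b n = false ->
  (forall i, (i < n)%nat -> a i = b i) -> cantor_real b < cantor_real a.
Proof.
  intros Ha Hb H.
  destruct (proj2_sig (cantor_sum_lub a)) as [Ua _], (proj2_sig (cantor_sum_lub b)) as [_ Lb].
  fold (cantor_real a) in Ua. fold (cantor_real b) in Lb.
  assert (P : 0 < (/ 3) ^ n) by (apply pow_lt; lra).
  assert (E : cantor_sum b (S n) = cantor_sum a n).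
  { simpl. rewrite Hb, (cantor_sum_ext a b n H). lra. }
  assert (cantor_sum a (S n) <= cantor_real a) by (apply Ua; eauto). simpl in H0. rewrite Ha in H0.
  assert (cantor_real b <= cantor_sum a n + 1 / 2 * (/ 3) ^ n); [|lra].
  apply Lb. intros r [m ->]. destruct (Nat.le_gt_cases (S n) m) as [L|L].
  - pose proof (cantor_sum_tail b (S n) m L) as T. rewrite E in T. simpl in T.
    assert (0 < (/ 3) ^ m) by (apply pow_lt; lra). lra.
  - assert (cantor_sum b m <= cantor_sum b (S n)) by (apply cantor_sum_mono; lia). lra.
Qed.

Lemma cantor_real_inj a b : cantor_real a = cantor_real b -> a = b.
Proof.
  intros H. apply NNPP. intros Hn.
  destruct (first_difference a b Hn) as [n [D L]].
  destruct (a n) eqn:Ea, (b n) eqn:Eb; try congruence.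
  - pose proof (cantor_real_lt a b n Ea Eb L). lra.
  - pose proof (cantor_real_lt b a n Eb Ea (fun i Hi => eq_sym (L i Hi))). lra.
Qed.

Definition decide (P : Prop) : bool := if excluded_middle_informative P then true else false.

Lemma decide_true P : decide P = true <-> P.
Proof. unfold decide. destruct (excluded_middle_informative P); split; intros; try easy. Qed.

Lemma decide_ext P Q : decide P = decide Q -> (P <-> Q).
Proof. intros H. rewrite <- (decide_true P), <- (decide_true Q), H. tauto. Qed.

Lemma fraction_between x y : x < y -> exists a b c : nat, x < (INR a - INR b) / INR (S c) < y.
Proof.
  intros H. destruct (archimed_cor1 (y - x)) as [c [Hc Hc0]]; [lra|].
  destruct c as [|c]; [lia|].
  assert (P : 0 < INR (S c)) by (apply lt_0_INR; lia).
  set (z := up (x * INR (S c))).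
  destruct (archimed (x * INR (S c))) as [A1 A2]. fold z in A1, A2.
  exists (Z.to_nat z), (Z.to_nat (- z)), c.
  assert (E : INR (Z.to_nat z) - INR (Z.to_nat (- z)) = IZR z).
  { rewrite !INR_IZR_INZ, <- minus_IZR. f_equal. lia. }
  rewrite E.
  assert (I : / INR (S c) * INR (S c) = 1) by (field; lra).
  split.
  - apply Rmult_lt_reg_r with (INR (S c)); [exact P|]. unfold Rdiv. rewrite Rmult_assoc, I. lra.
  - apply Rmult_lt_reg_r with (INR (S c)); [exact P|]. unfold Rdiv. rewrite Rmult_assoc, I.
    assert (1 < (y - x) * INR (S c)); [|lra].
    rewrite <- I. apply Rmult_lt_compat_r; assumption.
Qed.

(** The Dedekind cut of [r] as a point of the Cantor space: every rational is a fraction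
    [(a - b) / (c + 1)] of natural numbers, and injectivity is density of the rationals. *)
Definition real_cut (r : R) (n : nat) : bool :=
  let (a, m) := Cantor.of_nat n in let (b, c) := Cantor.of_nat m in
  decide ((INR a - INR b) / INR (S c) < r).

Lemma real_cut_inj r s : real_cut r = real_cut s -> r = s.
Proof.
  assert (W : forall r s, real_cut r = real_cut s -> r < s -> False).
  { clear. intros r s H L. destruct (fraction_between r s L) as [a [b [c [A B]]]].
    apply (f_equal (fun f => f (Cantor.to_nat (a, Cantor.to_nat (b, c))))) in H.
    unfold real_cut in H. rewrite !Cantor.cancel_of_to in H.
    apply decide_ext in H. apply H in B. lra. }
  intros H. destruct (Rtotal_order r s) as [L|[E|L]]; [|exact E|]; exfalso; eauto.
Qed.

(* Cantor-Schroeder-Bernstein: points of the forward orbits of [~ T] are moved by [i], the others are fixed. *)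
Lemma bijection_onto_subset (T : R -> Prop) (i : R -> R) :
  (forall r s, i r = i s -> r = s) -> (forall r, T (i r)) ->
  exists B : R -> R, (forall r s, B r = B s -> r = s) /\ (forall r, T (B r)) /\
    forall y, T y -> exists r, B r = y.
Proof.
  intros Hi HT.
  set (N := fun r => exists n y, ~ T y /\ r = Nat.iter n i y).
  exists (fun r => if excluded_middle_informative (N r) then i r else r).
  assert (NS : forall r, N r -> N (i r)).
  { intros r [n [y [Hy ->]]]. exists (S n), y. auto. }
  split; [|split].
  - intros r s. destruct (excluded_middle_informative (N r)) as [Nr|Nr],
      (excluded_middle_informative (N s)) as [Ns|Ns]; intros H; auto.
    + exfalso; apply Ns; subst; auto.
    + exfalso; apply Nr; subst; auto.
  - intros r. destruct (excluded_middle_informative (N r)) as [Nr|Nr]; auto.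
    apply NNPP. intros Hr. apply Nr. exists 0%nat, r. auto.
  - intros y Hy. destruct (classic (N y)) as [Ny|Ny].
    + destruct Ny as [[|n] [z [Hz E]]]; [simpl in E; subst; tauto|].
      exists (Nat.iter n i z).
      destruct (excluded_middle_informative _) as [_|F]; [simpl in E; auto|].
      exfalso; apply F. exists n, z. auto.
    + exists y. destruct (excluded_middle_informative _); tauto.
Qed.

(** Applied to chosen representatives, [v] injects the classes into the Cantor space and so, as [w],
    into the reals. The set of values of [w] contains, through [u], a copy of the reals, hence is in
    bijection with them. *)
Lemma continuum_quotient_of_injections {A : Type} (P : A -> Prop) (E : A -> A -> Prop)
  (u : (nat -> bool) -> A) (v : A -> nat -> bool) :
  (forall a, P a -> E a a) ->
  (forall a b, P a -> P b -> E a b -> E b a) ->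
  (forall a b c, P a -> P b -> P c -> E a b -> E b c -> E a c) ->
  (forall x, P (u x)) ->
  (forall x y, E (u x) (u y) -> x = y) ->
  (forall a b, P a -> P b -> v a = v b -> E a b) ->
  continuum_quotient P E.
Proof.
  intros Er Es Et Pu Iu Iv.
  assert (inh : inhabited A) by (constructor; exact (u (fun _ => true))).
  set (rep := fun a => epsilon inh (fun b => P b /\ E a b)).
  assert (rep_spec : forall a, P a -> P (rep a) /\ E a (rep a)).
  { intros a Ha. apply (epsilon_spec inh (fun b => P b /\ E a b)). eauto. }
  assert (rep_eq : forall a b, P a -> P b -> E a b -> rep a = rep b).
  (* Equivalent points have the same class as a predicate, and [epsilon] depends only on the
     predicate. *)
  { intros a b Ha Hb Hab. unfold rep. f_equal. extensionality c.
    apply propositional_extensionality. split; intros [Hc ?]; eauto. }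
  set (w := fun a => cantor_real (v (rep a))).
  assert (w_spec : forall a b, P a -> P b -> (w a = w b <-> E a b)).
  { intros a b Ha Hb. destruct (rep_spec a Ha), (rep_spec b Hb). split.
    - intros H3%cantor_real_inj%Iv; auto.
      apply Et with (rep a); auto. apply Et with (rep b); auto.
    - intros H3%rep_eq; auto. unfold w. congruence. }
  destruct (bijection_onto_subset (fun y => exists a, P a /\ w a = y)
    (fun r => w (u (real_cut r)))) as [B [BI [BT BS]]].
  - intros r s H%w_spec; auto. apply real_cut_inj, Iu, H.
  - eauto.
  - exists (fun a => epsilon (inhabits 0) (fun r => B r = w a)).
    assert (B_spec : forall a, P a -> B (epsilon (inhabits 0) (fun r => B r = w a)) = w a).
    { intros a Ha. apply (epsilon_spec (inhabits 0) (fun r => B r = w a)). apply BS. eauto. }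
    split.
    + intros a b Ha Hb. rewrite <- w_spec by assumption.
      cbv beta. split; intros H; [|rewrite H; reflexivity].
      rewrite <- (B_spec a Ha), <- (B_spec b Hb). congruence.
    + intros r. destruct (BT r) as [a [Ha Hr]]. exists a. split; [exact Ha|].
      apply BI. rewrite B_spec; auto.
Qed.

(** * Baire category on the square of the Cantor space *)

Definition agree (n : nat) (a b : nat -> bool) : Prop := forall i, (i < n)%nat -> a i = b i.

Lemma agree_refl n a : agree n a a.
Proof. intros i _. reflexivity. Qed.

Lemma agree_sym n a b : agree n a b -> agree n b a.
Proof. intros H i Hi. symmetry. auto. Qed.

Lemma agree_trans n a b c : agree n a b -> agree n b c -> agree n a c.
Proof. intros H K i Hi. rewrite H, K; auto. Qed.

Lemma agree_le n m a b : (n <= m)%nat -> agree m a b -> agree n a b.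
Proof. intros L H i Hi. apply H. lia. Qed.

Lemma agree_0 a b : agree 0 a b.
Proof. intros i Hi. lia. Qed.

#[local] Hint Resolve agree_refl agree_sym agree_0 : core.

Definition dense_open (D : (nat -> bool) -> (nat -> bool) -> Prop) : Prop :=
  (forall a b, D a b -> exists n, forall a' b', agree n a a' -> agree n b b' -> D a' b') /\
  (forall a b n, exists a' b', agree n a a' /\ agree n b b' /\ D a' b').

(* [(a, b, n)] stands for the basic open set of all pairs that agree with [(a, b)] below [n]. *)
Definition comeager_in (a b : nat -> bool) (n : nat) (S : (nat -> bool) -> (nat -> bool) -> Prop) : Prop :=
  exists D : nat -> (nat -> bool) -> (nat -> bool) -> Prop,
    (forall k, dense_open (D k)) /\
    forall a' b', agree n a a' -> agree n b b' -> (forall k, D k a' b') -> S a' b'.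

Definition meager_in a b n (S : (nat -> bool) -> (nat -> bool) -> Prop) : Prop :=
  comeager_in a b n (fun a b => ~ S a b).

Lemma comeager_in_countable (I : Type) (D : I -> (nat -> bool) -> (nat -> bool) -> Prop)
  a b n (S : (nat -> bool) -> (nat -> bool) -> Prop) :
  countable I -> (forall i, dense_open (D i)) ->
  (forall a' b', agree n a a' -> agree n b b' -> (forall i, D i a' b') -> S a' b') ->
  comeager_in a b n S.
Proof.
  intros [f Hf] HD HS. exists (fun k => D (f k)). split; [auto|].
  intros a' b' Ha Hb H. apply HS; auto. intros i. destruct (Hf i) as [k <-]. auto.
Qed.

Lemma agree_limit (x : nat -> nat -> bool) (n : nat -> nat) :
  (forall k, (n k < n (S k))%nat) -> (forall k, agree (n k) (x k) (x (S k))) ->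
  exists y, forall k, agree (n k) (x k) y.
Proof.
  intros Hn Hx.
  assert (Hk : forall k, (k <= n k)%nat).
  { induction k as [|k IH]; [lia|]. specialize (Hn k). lia. }
  assert (Hm : forall k l, (k <= l)%nat -> (n k <= n l)%nat /\ agree (n k) (x k) (x l)).
  { intros k l. induction 1 as [|l _ [IH1 IH2]]; [auto|]. specialize (Hn l). split; [lia|].
    eapply agree_trans; [exact IH2|]. eapply agree_le; [exact IH1|]. apply Hx. }
  (* Coordinate [i] is settled from stage [S i] on, because [n] is strictly increasing and so
     [i < n (S i)]. *)
  exists (fun i => x (S i) i). intros k i Hi.
  destruct (Nat.le_gt_cases k (S i)) as [L|L].
  - apply (Hm k (S i) L). exact Hi.
  - symmetry. apply (Hm (S i) k); [lia|]. specialize (Hk (S i)). lia.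
Qed.

Lemma dense_open_step D : dense_open D -> forall a b n,
  exists a' b' n', (n < n')%nat /\ agree n a a' /\ agree n b b' /\
    forall c d, agree n' a' c -> agree n' b' d -> D c d.
Proof.
  intros [O Dn] a b n. destruct (Dn a b n) as [a' [b' [Ha [Hb H]]]].
  destruct (O a' b' H) as [m Hm]. exists a', b', (Nat.max (S n) m).
  repeat split; auto; [lia|]. intros c d Hc Hd.
  apply Hm; eapply agree_le; try eassumption; lia.
Qed.

Lemma baire (D : nat -> (nat -> bool) -> (nat -> bool) -> Prop) :
  (forall k, dense_open (D k)) -> forall a b n,
  exists a' b', agree n a a' /\ agree n b b' /\ forall k, D k a' b'.
Proof.
  intros HD a b n.
  set (St := ((nat -> bool) * (nat -> bool) * nat)%type).
  assert (step : forall k (s : St), exists s' : St,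
    (snd s < snd s')%nat /\ agree (snd s) (fst (fst s)) (fst (fst s')) /\
    agree (snd s) (snd (fst s)) (snd (fst s')) /\
    forall c d, agree (snd s') (fst (fst s')) c -> agree (snd s') (snd (fst s')) d -> D k c d).
  { intros k [[a0 b0] n0]. destruct (dense_open_step _ (HD k) a0 b0 n0) as [a' [b' [n' H]]].
    exists (a', b', n'). exact H. }
  set (next := fun k s => proj1_sig (constructive_indefinite_description _ (step k s))).
  assert (Hnext : forall k s, _) by
    (intros k s; exact (proj2_sig (constructive_indefinite_description _ (step k s)))).
  set (st := fix st k := match k with O => (a, b, n) | S k => next k (st k) end).
  assert (Hst : forall k, _) by (intros k; exact (Hnext k (st k))).
  destruct (agree_limit (fun k => fst (fst (st k))) (fun k => snd (st k))) as [a' Ha];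
    [intros k; apply (Hst k)..|].
  destruct (agree_limit (fun k => snd (fst (st k))) (fun k => snd (st k))) as [b' Hb];
    [intros k; apply (Hst k)..|].
  exists a', b'. split; [exact (Ha 0%nat)|]. split; [exact (Hb 0%nat)|].
  intros k. apply (Hst k). apply (Ha (S k)). apply (Hb (S k)).
Qed.

Lemma comeager_in_mono a b n (S T : (nat -> bool) -> (nat -> bool) -> Prop) :
  (forall a b, S a b -> T a b) -> comeager_in a b n S -> comeager_in a b n T.
Proof. intros H [D [HD HS]]. exists D. auto. Qed.

Lemma dense_open_full : dense_open (fun _ _ => True).
Proof. split; [exists 0%nat; auto|]. intros a b n. exists a, b. auto. Qed.

Lemma meager_in_countable_union a b n (S : nat -> (nat -> bool) -> (nat -> bool) -> Prop) :
  (forall k, meager_in a b n (S k)) -> meager_in a b n (fun a b => exists k, S k a b).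
Proof.
  intros H.
  set (D := fun k => proj1_sig (constructive_indefinite_description _ (H k))).
  assert (HD : forall k, _) by
    (intros k; exact (proj2_sig (constructive_indefinite_description _ (H k)))).
  apply (comeager_in_countable (nat * nat) (fun i => D (fst i) (snd i))).
  - apply countable_prod; apply countable_nat.
  - intros [k l]. apply (HD k).
  - intros a' b' Ha Hb Hi [k Hk]. revert Hk. apply (HD k); auto. intros l. exact (Hi (k, l)).
Qed.

(** The binary digits of natural numbers form a countable dense set, so every basic open set has a
    code by natural numbers. *)
Lemma agree_testbit n a : exists c, agree n a (Nat.testbit c).
Proof.
  revert a. induction n as [|n IH]; intros a; [exists 0%nat; auto|].
  destruct (IH (fun i => a (S i))) as [c Hc]. exists (2 * c + Nat.b2n (a 0%nat))%nat.
  intros [|i] Hi.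
  - symmetry. apply Nat.testbit_0_r.
  - rewrite Nat.testbit_succ_r. apply Hc. lia.
Qed.

Definition hereditarily_nonmeager a b n (S : (nat -> bool) -> (nat -> bool) -> Prop) : Prop :=
  forall a' b' n', (n <= n')%nat -> agree n a a' -> agree n b b' -> ~ meager_in a' b' n' S.

(* The contrapositive of the Banach category theorem, restricted to one basic open set. *)
Lemma nonmeager_localize a b n S : ~ meager_in a b n S ->
  exists a' b' n', (n <= n')%nat /\ agree n a a' /\ agree n b b' /\ hereditarily_nonmeager a' b' n' S.
Proof.
  intros HS. apply NNPP. intros Hn. apply HS. clear HS.
  assert (Hd : forall a' b' n', (n <= n')%nat -> agree n a a' -> agree n b b' ->
    exists a1 b1 n1, (n' <= n1)%nat /\ agree n' a' a1 /\ agree n' b' b1 /\ meager_in a1 b1 n1 S).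
  { intros a' b' n' L Ha Hb. apply NNPP. intros K. apply Hn. exists a', b', n'.
    repeat split; auto. intros a1 b1 n1 L1 Ha1 Hb1 M. apply K. exists a1, b1, n1. auto. }
  set (wit := fun (a b : nat -> bool) n (D : nat -> (nat -> bool) -> (nat -> bool) -> Prop) =>
    (forall k, dense_open (D k)) /\ (meager_in a b n S -> forall a' b', agree n a a' -> agree n b b' ->
       (forall k, D k a' b') -> ~ S a' b')).
  assert (W : forall a b n, exists D, wit a b n D).
  { intros a1 b1 n1. destruct (classic (meager_in a1 b1 n1 S)) as [[D [HD HS]]|N].
    - exists D. split; auto.
    - exists (fun _ _ _ => True). split; [|tauto]. intros _. apply dense_open_full. }
  set (D := fun a b n => proj1_sig (constructive_indefinite_description _ (W a b n))).
  assert (HD : forall a b n, wit a b n (D a b n)) by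
    (intros a1 b1 n1; exact (proj2_sig (constructive_indefinite_description _ (W a1 b1 n1)))).
  clearbody D.
  (* [U] is dense open: inside the box it consists of the points with a basic neighbourhood in which
     [S] is meager, and outside the box it imposes nothing. A generic point of the box lies in [U],
     and a coded box around it supplies the dense open sets that keep it out of [S]. *)
  set (U := fun a1 b1 => (agree n a a1 -> agree n b b1 -> exists m, meager_in a1 b1 m S)).
  apply (comeager_in_countable (bool * (nat * nat * nat * nat)) (fun i => let '(t, (c, d, m, k)) := i in
    if t : bool then U else D (Nat.testbit c) (Nat.testbit d) m k)).
  - repeat apply countable_prod; auto using countable_nat, countable_bool.
  - intros [[] [[[c d] m] k]]; [|apply HD]. split.
    + intros a1 b1 H.
      destruct (classic (agree n a a1 /\ agree n b b1)) as [[H1 H2]|H'].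
      * destruct (H H1 H2) as [l Hl]. exists l. intros a2 b2 H3 H4 _ _. exists l.
        destruct Hl as [D' [HD' HS']]. exists D'. split; [auto|].
        intros a3 b3 H5 H6. apply HS'; eapply agree_trans; eassumption.
      * exists n. intros a2 b2 H1 H2 H3 H4. exfalso; apply H'.
        split; eapply agree_trans; try eassumption; auto.
    + intros a1 b1 n1.
      destruct (classic (agree n a a1 /\ agree n b b1)) as [[H1 H2]|H'].
      * destruct (Hd a1 b1 (Nat.max n n1)) as [a2 [b2 [n2 [L [Ha [Hb M]]]]]]; auto; [lia|].
        exists a2, b2. split; [|split].
        -- eapply agree_le; [|exact Ha]; lia.
        -- eapply agree_le; [|exact Hb]; lia.
        -- intros _ _. eauto.
      * exists a1, b1. split; [auto|split; [auto|]]. intros H1 H2. tauto.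
  - intros a1 b1 Ha Hb H.
    destruct (H (true, (0, 0, 0, 0)%nat) Ha Hb) as [m Hm].
    destruct (agree_testbit m a1) as [c Hc], (agree_testbit m b1) as [d Hd1].
    destruct (HD (Nat.testbit c) (Nat.testbit d) m) as [_ K].
    apply K; auto.
    + destruct Hm as [D' [HD' HS']]. exists D'. split; [auto|].
      intros a3 b3 H5 H6. apply HS'; eapply agree_trans; eassumption.
    + intros k. exact (H (false, (c, d, m, k))).
Qed.

(** * The Baire property of analytic relations *)

Fixpoint branch_prefix (br : nat -> nat) (l : nat) : list nat :=
  match l with O => nil | S l => br l :: branch_prefix br l end.

(* The Baire property of analytic sets, in the form: if the root of a Souslin scheme is
   nonmeager, then the set of points in the closure of some branch is comeager in some basic
   open set. A generic point of [hereditarily_nonmeager] for [A s] has this property for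
   some immediate successor of [s]. *)
Lemma souslin_comeager (A : list nat -> (nat -> bool) -> (nat -> bool) -> Prop)
  (E : (nat -> bool) -> (nat -> bool) -> Prop) :
  (forall s a b, A s a b -> exists k, A (k :: s) a b) ->
  (forall a b br, (forall l, exists a' b', agree l a a' /\ agree l b b' /\
     A (branch_prefix br l) a' b') -> E a b) ->
  forall a b n, ~ meager_in a b n (A nil) -> exists a' b' n', comeager_in a' b' n' E.
Proof.
  intros Hsplit Hclosed a b n HN.
  destruct (nonmeager_localize _ _ _ _ HN) as [a0 [b0 [n0 [_ [_ [_ H0]]]]]].
  exists a0, b0, n0.
  set (O := fun s a b => exists n, hereditarily_nonmeager a b n (A s)).
  assert (Oshift : forall s a b n a' b', agree n a a' -> agree n b b' ->
    hereditarily_nonmeager a b n (A s) -> hereditarily_nonmeager a' b' n (A s)).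
  { intros s a1 b1 n1 a2 b2 H1 H2 H a3 b3 n3 L H3 H4.
    apply H; auto; eapply agree_trans; eassumption. }
  (* The set for [s] asks that the point lies in some [O (k :: s)] or has a neighbourhood disjoint
     from [O s]. At a point of [O nil] in all these sets, the successors chosen one after another
     form the branch. *)
  apply (comeager_in_countable (list nat) (fun s a b => (exists k, O (k :: s) a b) \/
    exists n, forall a' b', agree n a a' -> agree n b b' -> ~ O s a' b')).
  - apply countable_list, countable_nat.
  - intros s. split.
    + intros a1 b1 [[k [m H]]|[m H]].
      * exists m. intros a2 b2 H1 H2. left. exists k, m. eauto.
      * exists m. intros a2 b2 H1 H2. right. exists m. intros a3 b3 H3 H4.
        apply H; eapply agree_trans; eassumption.
    + intros a1 b1 n1.
      destruct (classic (exists a' b', agree n1 a1 a' /\ agree n1 b1 b' /\ O s a' b'))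
        as [[a2 [b2 [Ha2 [Hb2 [m Hm]]]]]|N].
      * assert (M : exists k, ~ meager_in a2 b2 (Nat.max n1 m) (A (k :: s))).
        (* [A s] is covered by the countably many [A (k :: s)], so they cannot all be meager in a
           box where [A s] is not. *)
        { apply not_all_ex_not. intros M. apply meager_in_countable_union in M.
          apply (Hm a2 b2 (Nat.max n1 m)); auto; [lia|].
          eapply comeager_in_mono; [|exact M]. cbv beta. intros a3 b3 K J. apply K. auto. }
        destruct M as [k M].
        destruct (nonmeager_localize _ _ _ _ M) as [a3 [b3 [n3 [L [Ha3 [Hb3 H3]]]]]].
        exists a3, b3. split; [|split; [|left; exists k, n3; exact H3]].
        -- eapply agree_trans; [exact Ha2|]. eapply agree_le; [|exact Ha3]; lia.
        -- eapply agree_trans; [exact Hb2|]. eapply agree_le; [|exact Hb3]; lia.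
      * exists a1, b1. repeat split; auto. right. exists n1. intros a' b' H1 H2 H3.
        apply N. eauto.
  - intros a1 b1 Ha Hb H.
    assert (step : forall s, exists k, O s a1 b1 -> O (k :: s) a1 b1).
    { intros s. destruct (H s) as [[k Hk]|[m Hm]]; [exists k; auto|].
      exists 0%nat. intros K. exfalso. eapply Hm; eauto. }
    set (next := fun s => proj1_sig (constructive_indefinite_description _ (step s))).
    assert (Hnext : forall s, O s a1 b1 -> O (next s :: s) a1 b1) by
      (intros s; exact (proj2_sig (constructive_indefinite_description _ (step s)))).
    set (st := fix st l := match l with O => nil | S l => next (st l) :: st l end).
    apply (Hclosed a1 b1 (fun l => next (st l))). intros l.
    assert (P : branch_prefix (fun l => next (st l)) l = st l).
    { induction l as [|l IH]; [reflexivity|]. simpl. rewrite IH. reflexivity. }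
    rewrite P.
    assert (K : O (st l) a1 b1).
    { clear P. induction l as [|l IH]; [exists n0; eauto|]. apply Hnext, IH. }
    (* A set that misses a box is meager there, so nonmeagerness in all small boxes around the point
       gives elements of [A (st l)] arbitrarily close to it. *)
    destruct K as [m Hm]. apply NNPP. intros N.
    apply (Hm a1 b1 (Nat.max m l)); auto; [lia|].
    exists (fun _ _ _ => True). split; [intros _; apply dense_open_full|].
    intros a2 b2 H1 H2 _ H3. apply N. exists a2, b2.
    repeat split; auto; eapply agree_le; try eassumption; lia.
Qed.

Definition flip (n : nat) (b : nat -> bool) (i : nat) : bool :=
  if Nat.eqb i n then negb (b i) else b i.

Lemma flip_flip n b : flip n (flip n b) = b.
Proof.
  extensionality i. unfold flip. destruct (Nat.eqb i n); [apply Bool.negb_involutive|reflexivity].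
Qed.

Lemma flip_agree n m b c : agree m b c -> agree m (flip n b) (flip n c).
Proof. intros H i Hi. unfold flip. rewrite (H i Hi). reflexivity. Qed.

Lemma flip_agree_below n b : agree n b (flip n b).
Proof. intros i Hi. unfold flip. destruct (Nat.eqb_spec i n); [lia|reflexivity]. Qed.

Lemma flip_not_comeager (E : (nat -> bool) -> (nat -> bool) -> Prop) :
  (forall x y, E x y -> E y x) -> (forall x y z, E x y -> E y z -> E x z) ->
  (forall n x, ~ E x (flip n x)) ->
  forall a b n, ~ comeager_in a b n E.
Proof.
  intros Es Et Ef a b n [D [HD HE]].
  (* The family contains each [D j] and its preimage under flipping coordinate [n] of the second
     argument. As [n] is the length of the box, this flip does not leave the box. *)
  destruct (baire (fun k a b => let (j, i) := Cantor.of_nat k in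
    D j a (if Nat.eqb i 0 then b else flip n b))) with a b n as [x [y [Hx [Hy H]]]].
  - intros k. destruct (Cantor.of_nat k) as [j i]. destruct (Nat.eqb i 0); [apply HD|].
    destruct (HD j) as [O Dn]. split.
    + intros a1 b1 H. destruct (O _ _ H) as [m Hm]. exists m. intros a2 b2 H1 H2.
      apply Hm; auto using flip_agree.
    + intros a1 b1 m. destruct (Dn a1 (flip n b1) m) as [a2 [b2 [H1 [H2 H3]]]].
      exists a2, (flip n b2). rewrite flip_flip. repeat split; auto.
      rewrite <- (flip_flip n b1). auto using flip_agree.
  - assert (Ej : forall j i, D j x (if Nat.eqb i 0 then y else flip n y)).
    { intros j i. specialize (H (Cantor.to_nat (j, i))). rewrite Cantor.cancel_of_to in H. exact H. }
    apply (Ef n y). apply Et with x.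
    + apply Es, HE; auto. intros k. exact (Ej k 0%nat).
    + apply HE; auto; [|intros k; exact (Ej k 1%nat)].
      eapply agree_trans; [exact Hy|apply flip_agree_below].
Qed.

(** * Mycielski's theorem and perfectly many classes *)

Fixpoint bool_prefix (x : nat -> bool) (l : nat) : list bool :=
  match l with O => nil | S l => x l :: bool_prefix x l end.

Lemma bool_prefix_neq x y n l : x n <> y n -> (n < l)%nat -> bool_prefix x l <> bool_prefix y l.
Proof.
  intros H. induction 1 as [|l _ IH]; simpl; congruence.
Qed.

Lemma bool_prefix_enumerated l : exists L, forall x, In (bool_prefix x l) L.
Proof.
  induction l as [|l [L HL]]; [exists (nil :: nil); simpl; auto|].
  exists (map (cons true) L ++ map (cons false) L). intros x. simpl.
  apply in_or_app. destruct (x l); [left|right]; apply in_map, HL.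
Qed.

(* Mycielski's theorem on the Cantor space: a fusion along the binary tree in which, at stage
   [l], all pairs of distinct nodes of length [l] are pushed into the first [l] dense open sets. *)
Lemma mycielski (D : nat -> (nat -> bool) -> (nat -> bool) -> Prop) :
  (forall k, dense_open (D k)) ->
  exists f : (nat -> bool) -> nat -> bool, forall x y, x <> y -> forall k, D k (f x) (f y).
Proof.
  intros HD.
  (* A state assigns a point to every node of the binary tree, of which the digits below the second
     component are fixed. [ok] says that these digits alone force the pair at [p] and [q] into
     [D k]. *)
  set (St := ((list bool -> nat -> bool) * nat)%type).
  set (ext := fun s s' : St => (snd s <= snd s')%nat /\ forall t, agree (snd s) (fst s t) (fst s' t)).
  set (ok := fun (s : St) (t : list bool * list bool * nat) => let '(p, q, k) := t in p <> q ->
    forall c d, agree (snd s) (fst s p) c -> agree (snd s) (fst s q) d -> D k c d).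
  assert (extok : forall s s' t, ext s s' -> ok s t -> ok s' t).
  { intros s s' [[p q] k] [L H] Hok N c d Hc Hd.
    apply Hok; auto; (eapply agree_trans; [apply H|]; eapply agree_le; eassumption). }
  assert (exttrans : forall s s' s'', ext s s' -> ext s' s'' -> ext s s'').
  { intros s s' s'' [L H] [L' H']. split; [lia|]. intros t.
    eapply agree_trans; [apply H|]. eapply agree_le; [exact L|apply H']. }
  assert (one : forall s t, exists s', ext s s' /\ ok s' t).
  { intros [sg n] [[p q] k]. destruct (classic (p = q)) as [e|ne].
    { exists (sg, n). split; [split; auto|]. intros N. tauto. }
    destruct (dense_open_step _ (HD k) (sg p) (sg q) n) as [a [b [n' [L [Ha [Hb H]]]]]].
    exists (fun t => if list_eq_dec Bool.bool_dec t p then a else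
      if list_eq_dec Bool.bool_dec t q then b else sg t, n').
    split; [split; [simpl; lia|]|].
    - intros t. simpl. destruct (list_eq_dec Bool.bool_dec t p) as [->|_]; auto.
      destruct (list_eq_dec Bool.bool_dec t q) as [->|_]; auto.
    - intros _ c d. simpl. destruct (list_eq_dec Bool.bool_dec p p) as [_|N]; [|tauto].
      destruct (list_eq_dec Bool.bool_dec q p) as [e|_]; [congruence|].
      destruct (list_eq_dec Bool.bool_dec q q) as [_|N]; [|tauto]. apply H. }
  assert (many : forall T s, exists s', ext s s' /\ forall t, In t T -> ok s' t).
  { induction T as [|t T IH]; intros s.
    - exists s. split; [split; auto|]. intros t [].
    - destruct (one s t) as [s1 [E1 O1]], (IH s1) as [s2 [E2 O2]].
      exists s2. split; [eauto|]. intros t' [<-|Ht]; eauto. }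
  assert (step : forall l (s : St), exists s' : St, (snd s < snd s')%nat /\
    (forall e t, agree (snd s) (fst s t) (fst s' (e :: t))) /\
    forall x y k, (k <= l)%nat -> ok s' (bool_prefix x (S l), bool_prefix y (S l), k)).
  { intros l [sg n]. destruct (bool_prefix_enumerated (S l)) as [L HL].
    (* Both children start from the point of their parent, which is [tl t] because the newest bit is
       the head; [S n] makes the number of fixed digits grow strictly. *)
    destruct (many (list_prod (list_prod L L) (seq 0 (S l))) (fun t => sg (tl t), S n)) as [s' [[L' E'] O']].
    simpl in L'. exists s'. split; [simpl; lia|]. split.
    - intros e t. simpl. eapply agree_le; [|apply (E' (e :: t))]. simpl; lia.
    - intros x y k Hk. apply O'. apply in_prod; [apply in_prod; apply HL|].
      apply in_seq. lia. }
  set (next := fun l s => proj1_sig (constructive_indefinite_description _ (step l s))).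
  assert (Hnext : forall l s, _) by
    (intros l s; exact (proj2_sig (constructive_indefinite_description _ (step l s)))).
  set (st := fix st l : St := match l with O => (fun _ _ => true, 0%nat) | S l => next l (st l) end).
  assert (Hst : forall l, _) by (intros l; exact (Hnext l (st l))).
  assert (lim : forall x, exists y, forall l, agree (snd (st l)) (fst (st l) (bool_prefix x l)) y).
  { intros x. apply (agree_limit (fun l => fst (st l) (bool_prefix x l)) (fun l => snd (st l))).
    - intros l. apply (Hst l).
    - intros l. apply (Hst l). }
  set (f := fun x => proj1_sig (constructive_indefinite_description _ (lim x))).
  assert (Hf : forall x, _) by
    (intros x; exact (proj2_sig (constructive_indefinite_description _ (lim x)))).
  exists f. intros x y N k.
  destruct (first_difference x y N) as [n [Hn _]].
  (* Prefixes of length [S l] already differ at [n], and stage [l] treats all sets up to index [l],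
     in particular [D k]. *)
  set (l := Nat.max n k).
  apply (proj2 (proj2 (Hst l)) x y k); [lia| |apply (Hf x (S l))|apply (Hf y (S l))].
  apply bool_prefix_neq with n; [exact Hn|lia].
Qed.

(** The three conditions on [A] express that [E] is analytic: the root contains [E], each node is
    covered by its successors, and limits along a branch lie in [E]. The case distinction is on the
    root [A nil], not on [E] itself. *)
Lemma perfectly_many_classes (E : (nat -> bool) -> (nat -> bool) -> Prop)
  (A : list nat -> (nat -> bool) -> (nat -> bool) -> Prop) :
  (forall x y, E x y -> E y x) -> (forall x y z, E x y -> E y z -> E x z) ->
  (forall n x, ~ E x (flip n x)) ->
  (forall a b, E a b -> A nil a b) ->
  (forall s a b, A s a b -> exists k, A (k :: s) a b) ->
  (forall a b br, (forall l, exists a' b', agree l a a' /\ agree l b b' /\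
     A (branch_prefix br l) a' b') -> E a b) ->
  exists f : (nat -> bool) -> nat -> bool, forall x y, E (f x) (f y) -> x = y.
Proof.
  intros Es Et Ef EA Hs Hc.
  destruct (classic (meager_in (fun _ => true) (fun _ => true) 0 (A nil))) as [[D [HD M]]|N].
  - destruct (mycielski D HD) as [f Hf]. exists f. intros x y H. apply NNPP. intros Hn.
    apply (M (f x) (f y)); auto.
  - destruct (souslin_comeager A E Hs Hc _ _ _ N) as [a [b [n H]]].
    exfalso. eapply flip_not_comeager; eauto.
Qed.

(** * Paths and path congruences *)

(** Coordinate changes are real functions of two variables throughout; one variable is the case of a
    dummy second argument, so that one tactic serves both. *)
Definition rc2 (f : R -> R -> R) : Prop := forall x y, continuity_2d_pt f x y.

Lemma rc2_const c : rc2 (fun _ _ => c).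
Proof. intros x y. apply continuity_2d_pt_const. Qed.

Lemma rc2_fst : rc2 (fun s _ => s).
Proof. intros x y. apply continuity_2d_pt_id1. Qed.

Lemma rc2_snd : rc2 (fun _ t => t).
Proof. intros x y. apply continuity_2d_pt_id2. Qed.

Lemma rc2_plus f g : rc2 f -> rc2 g -> rc2 (fun s t => f s t + g s t).
Proof. intros Hf Hg x y. apply continuity_2d_pt_plus; auto. Qed.

Lemma rc2_minus f g : rc2 f -> rc2 g -> rc2 (fun s t => f s t - g s t).
Proof. intros Hf Hg x y. apply continuity_2d_pt_minus; auto. Qed.

Lemma rc2_mult f g : rc2 f -> rc2 g -> rc2 (fun s t => f s t * g s t).
Proof. intros Hf Hg x y. apply continuity_2d_pt_mult; auto. Qed.

Lemma rc2_abs f : rc2 f -> rc2 (fun s t => Rabs (f s t)).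
Proof. intros Hf x y. apply continuity_1d_2d_pt_comp; [apply Rcontinuity_abs|auto]. Qed.

Lemma rc2_min f g : rc2 f -> rc2 g -> rc2 (fun s t => Rmin (f s t) (g s t)).
Proof.
  intros Hf Hg x y.
  apply continuity_2d_pt_ext with (fun s t => (f s t + g s t - Rabs (f s t - g s t)) * / 2).
  - intros s t. unfold Rmin. destruct (Rle_dec (f s t) (g s t));
      [rewrite Rabs_left1 by lra | rewrite Rabs_right by lra]; lra.
  - revert x y. apply rc2_mult; [|apply rc2_const].
    apply rc2_minus; [apply rc2_plus|apply rc2_abs, rc2_minus]; assumption.
Qed.

Lemma rc2_max f g : rc2 f -> rc2 g -> rc2 (fun s t => Rmax (f s t) (g s t)).
Proof.
  intros Hf Hg x y.
  apply continuity_2d_pt_ext with (fun s t => f s t + g s t - Rmin (f s t) (g s t)).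
  - intros s t. unfold Rmin, Rmax. destruct (Rle_dec (f s t) (g s t)); lra.
  - revert x y. apply rc2_minus; [apply rc2_plus|apply rc2_min]; assumption.
Qed.

Ltac rc2 := repeat first [ assumption | apply rc2_fst | apply rc2_snd | apply rc2_const
  | apply rc2_minus | apply rc2_plus | apply rc2_mult | apply rc2_min | apply rc2_max ].

Definition clamp (t : R) : R := Rmax 0 (Rmin 1 t).

Lemma clamp_range t : 0 <= clamp t <= 1.
Proof. unfold clamp, Rmax, Rmin. repeat destruct (Rle_dec _ _); lra. Qed.

Lemma clamp_id t : 0 <= t <= 1 -> clamp t = t.
Proof. unfold clamp, Rmax, Rmin. repeat destruct (Rle_dec _ _); lra. Qed.

Lemma clamp_lipschitz s t : Rabs (clamp s - clamp t) <= Rabs (s - t).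
Proof.
  unfold clamp, Rmax, Rmin, Rabs. repeat destruct (Rle_dec _ _); repeat destruct (Rcase_abs _); lra.
Qed.

Lemma rc2_clamp f : rc2 f -> rc2 (fun s t => clamp (f s t)).
Proof. intros H. unfold clamp. rc2. Qed.

Section Paths.
Context {X : Type} (d : X -> X -> R) (Hm : is_metric d).

Lemma dist_tri x y z : d x z <= d x y + d y z.
Proof. apply Hm. Qed.

Lemma dist_sym x y : d x y = d y x.
Proof. apply Hm. Qed.

Lemma dist_refl x : d x x = 0.
Proof. apply Hm. reflexivity. Qed.

Lemma dist_nonneg x y : 0 <= d x y.
Proof. apply Hm. Qed.

Lemma dist_zero x y : (forall eps, 0 < eps -> d x y < eps) -> x = y.
Proof.
  intros H. apply Hm. destruct (dist_nonneg x y) as [P|P]; [|auto].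
  specialize (H _ P). lra.
Qed.

(** Paths and homotopies are total on the line and the plane, so that parameters may be arbitrary
    real expressions; only the values over the unit interval carry meaning. *)
Definition cR (g : R -> X) : Prop := forall t eps, 0 < eps -> exists delta, 0 < delta /\
  forall s, Rabs (s - t) < delta -> d (g s) (g t) < eps.

Definition c2R (H : R -> R -> X) : Prop := forall s t eps, 0 < eps -> exists delta, 0 < delta /\
  forall s' t', Rabs (s' - s) < delta -> Rabs (t' - t) < delta -> d (H s' t') (H s t) < eps.

Lemma cR_c2R g : cR g <-> c2R (fun s _ => g s).
Proof.
  split.
  - intros H s t eps He. destruct (H s eps He) as [e [P K]]. exists e. auto.
  - intros H t eps He. destruct (H t 0 eps He) as [e [P K]]. exists e. split; [auto|].
    intros s Hs. apply (K s 0); [auto|]. rewrite Rminus_0_r, Rabs_R0. exact P.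
Qed.

Lemma c2R_comp H f g : c2R H -> rc2 f -> rc2 g -> c2R (fun s t => H (f s t) (g s t)).
Proof.
  intros HH Hf Hg s t eps He.
  destruct (HH (f s t) (g s t) eps He) as [e [P K]].
  destruct (Hf s t (mkposreal e P)) as [d1 D1], (Hg s t (mkposreal e P)) as [d2 D2].
  exists (Rmin d1 d2). split; [apply Rmin_pos; apply cond_pos|].
  intros s' t' Hs Ht. pose proof (Rmin_l d1 d2). pose proof (Rmin_r d1 d2).
  apply K; [apply D1 | apply D2]; lra.
Qed.

Lemma cR_comp g u : cR g -> rc2 (fun s _ => u s) -> cR (fun s => g (u s)).
Proof.
  rewrite !cR_c2R. intros Hg Hu. apply (c2R_comp (fun s _ => g s) (fun s _ => u s) (fun _ t => t));
    auto; rc2.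
Qed.

Lemma c2R_comp1 g f : cR g -> rc2 f -> c2R (fun s t => g (f s t)).
Proof.
  rewrite cR_c2R. intros Hg Hf. apply (c2R_comp (fun s _ => g s) f (fun _ t => t)); auto; rc2.
Qed.

Lemma cR_const x : cR (fun _ => x).
Proof. intros t eps He. exists 1. split; [lra|]. intros s _. rewrite dist_refl. exact He. Qed.

Lemma c2R_paste a H1 H2 : c2R H1 -> c2R H2 -> (forall t, H1 a t = H2 a t) ->
  c2R (fun s t => if Rle_dec s a then H1 s t else H2 s t).
Proof.
  intros C1 C2 E s t eps He.
  destruct (C1 s t (eps / 3)) as [e1 [P1 K1]]; [lra|].
  destruct (C2 s t (eps / 3)) as [e2 [P2 K2]]; [lra|].
  exists (Rmin e1 e2). split; [apply Rmin_pos; auto|].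
  intros s' t' Hs Ht. pose proof (Rmin_l e1 e2). pose proof (Rmin_r e1 e2).
  assert (Q : forall r, Rabs (r - s) <= Rabs (s' - s) ->
    d (H1 r t') (H1 s t) < eps / 3 /\ d (H2 r t') (H2 s t) < eps / 3).
  { intros r Hr. split; [apply K1 | apply K2]; lra. }
  destruct (Rle_dec s' a), (Rle_dec s a).
  - destruct (Q s') as [A _]; lra.
  (* The seam [a] lies between [s'] and [s], so [(a, t')] is as close to [(s, t)] as needed, and
     there the two maps coincide. *)
  - destruct (Q s') as [A _]; [lra|]. destruct (Q a) as [A' B'].
    { unfold Rabs. destruct (Rcase_abs (a - s)), (Rcase_abs (s' - s)); lra. }
    pose proof (dist_tri (H1 s' t') (H1 s t) (H2 s t)).
    pose proof (dist_tri (H1 s t) (H1 a t') (H2 s t)).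
    rewrite (dist_sym (H1 s t) (H1 a t')) in H4. rewrite E in H4, A'. lra.
  - destruct (Q s') as [_ A]; [lra|]. destruct (Q a) as [A' B'].
    { unfold Rabs. destruct (Rcase_abs (a - s)), (Rcase_abs (s' - s)); lra. }
    pose proof (dist_tri (H2 s' t') (H2 s t) (H1 s t)).
    pose proof (dist_tri (H2 s t) (H2 a t') (H1 s t)).
    rewrite (dist_sym (H2 s t) (H2 a t')) in H4. rewrite E in A'. lra.
  - destruct (Q s') as [_ A]; lra.
Qed.

Lemma cR_paste a g h : cR g -> cR h -> g a = h a ->
  cR (fun s => if Rle_dec s a then g s else h s).
Proof.
  rewrite !cR_c2R. intros Hg Hh E. apply (c2R_paste a (fun s _ => g s) (fun s _ => h s)); auto.
Qed.

Lemma c2R_swap H : c2R H -> c2R (fun s t => H t s).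
Proof.
  intros C s t eps He. destruct (C t s eps He) as [e [P K]]. exists e. auto.
Qed.

(** The endpoints are part of the type, so concatenation needs no side condition; the price is that
    a path whose endpoint is only provably the required one has to be rebuilt. *)
Record pth (x y : X) : Type := Pth {
  pf :> R -> X;
  pth_cont : cR pf;
  pth_0 : pf 0 = x;
  pth_1 : pf 1 = y }.
#[global] Arguments pf {x y}.

Definition hpt {x y} (p q : pth x y) : Prop :=
  exists H, c2R H /\ (forall s, 0 <= s <= 1 -> H s 0 = p s) /\
    (forall s, 0 <= s <= 1 -> H s 1 = q s) /\ forall t, H 0 t = x /\ H 1 t = y.

(** Two reparametrisations of one map [G] with the same end parameters are homotopic by linear
    interpolation of the parameter, since the line is convex. The groupoid laws below are
    instances. *)
Lemma straight_line_homotopy {x y} (p q : pth x y) (G : R -> X) (u v : R -> R) :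
  cR G -> rc2 (fun s _ => u s) -> rc2 (fun s _ => v s) -> u 0 = v 0 -> u 1 = v 1 ->
  (forall s, 0 <= s <= 1 -> p s = G (u s)) -> (forall s, 0 <= s <= 1 -> q s = G (v s)) -> hpt p q.
Proof.
  intros HG Hu Hv E0 E1 Hp Hq.
  exists (fun s t => G (u s + t * (v s - u s))). split; [|split; [|split]].
  - apply (c2R_comp1 G (fun s t => u s + t * (v s - u s))); [exact HG|]. rc2.
  - intros s Hs. rewrite Hp by exact Hs. f_equal. lra.
  - intros s Hs. rewrite Hq by exact Hs. f_equal. lra.
  - intros t. split.
    + rewrite <- (pth_0 _ _ p), Hp by lra. f_equal. rewrite <- E0. lra.
    + rewrite <- (pth_1 _ _ p), Hp by lra. f_equal. rewrite <- E1. lra.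
Qed.

Lemma hpt_ext {x y} (p q : pth x y) : (forall s, 0 <= s <= 1 -> p s = q s) -> hpt p q.
Proof.
  intros E. apply straight_line_homotopy with (pf p) (fun s => s) (fun s => s); auto using pth_cont; rc2.
  intros s Hs. symmetry. auto.
Qed.

Lemma hpt_sym {x y} (p q : pth x y) : hpt p q -> hpt q p.
Proof.
  intros [H [C [H0 [H1 He]]]]. exists (fun s t => H s (1 - t)). split; [|split; [|split]].
  - apply c2R_comp; auto; rc2.
  - intros s Hs. rewrite Rminus_0_r. auto.
  - intros s Hs. replace (1 - 1) with 0 by lra. auto.
  - intros t. apply He.
Qed.

Lemma hpt_trans {x y} (p q r : pth x y) : hpt p q -> hpt q r -> hpt p r.
Proof.
  intros [H [C [H0 [H1 He]]]] [K [D [K0 [K1 Ke]]]].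
  (* [H] at time 1 and [K] at time 0 are known to coincide only for [s] in the unit interval, hence
     the clamp. *)
  exists (fun s t => if Rle_dec t (1 / 2) then H (clamp s) (2 * t) else K (clamp s) (2 * t - 1)).
  split; [|split; [|split]].
  - apply (c2R_swap (fun t s => if Rle_dec t (1 / 2) then H (clamp s) (2 * t) else K (clamp s) (2 * t - 1))).
    apply (c2R_paste (1 / 2) (fun t s => H (clamp s) (2 * t)) (fun t s => K (clamp s) (2 * t - 1))).
    + apply (c2R_comp H (fun t s => clamp s)); auto; [apply rc2_clamp|]; rc2.
    + apply (c2R_comp K (fun t s => clamp s)); auto; [apply rc2_clamp|]; rc2.
    + intros t. replace (2 * (1 / 2)) with 1 by lra. replace (1 - 1) with 0 by lra.
      pose proof (clamp_range t). rewrite H1, K0; auto.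
  - intros s Hs. destruct (Rle_dec 0 (1 / 2)); [|lra]. rewrite clamp_id, Rmult_0_r; auto.
  - intros s Hs. destruct (Rle_dec 1 (1 / 2)); [lra|]. rewrite clamp_id by auto.
    replace (2 * 1 - 1) with 1 by lra. auto.
  - intros t. rewrite (clamp_id 0), (clamp_id 1) by lra.
    destruct (Rle_dec t (1 / 2)); split; first [apply He | apply Ke].
Qed.

Definition cat_fun (g h : R -> X) (s : R) : X :=
  if Rle_dec s (1 / 2) then g (2 * s) else h (2 * s - 1).

Lemma cR_cat g h : cR g -> cR h -> g 1 = h 0 -> cR (cat_fun g h).
Proof.
  intros Hg Hh E. apply (cR_paste (1 / 2) (fun s => g (2 * s)) (fun s => h (2 * s - 1))).
  - apply cR_comp; auto; rc2.
  - apply (cR_comp h (fun s => 2 * s - 1)); auto; rc2.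
  - replace (2 * (1 / 2)) with 1 by lra. replace (1 - 1) with 0 by lra. exact E.
Qed.

Lemma cat_fun_0 g h : cat_fun g h 0 = g 0.
Proof. unfold cat_fun. destruct (Rle_dec 0 (1 / 2)); [|lra]. f_equal; lra. Qed.

Lemma cat_fun_1 g h : cat_fun g h 1 = h 1.
Proof. unfold cat_fun. destruct (Rle_dec 1 (1 / 2)); [lra|]. f_equal; lra. Qed.

Definition cat {x y z} (p : pth x y) (q : pth y z) : pth x z :=
  Pth x z (cat_fun p q)
    (cR_cat p q (pth_cont _ _ p) (pth_cont _ _ q) (eq_trans (pth_1 _ _ p) (eq_sym (pth_0 _ _ q))))
    (eq_trans (cat_fun_0 p q) (pth_0 _ _ p)) (eq_trans (cat_fun_1 p q) (pth_1 _ _ q)).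

Definition cst (x : X) : pth x x := Pth x x (fun _ => x) (cR_const x) eq_refl eq_refl.

Lemma reversal_cont {x y} (p : pth x y) : cR (fun s => p (1 - s)).
Proof. apply (cR_comp p (fun s => 1 - s)); [apply pth_cont|rc2]. Qed.

Definition reversal {x y} (p : pth x y) : pth y x :=
  Pth y x (fun s => p (1 - s)) (reversal_cont p)
    (eq_trans (f_equal p (Rminus_0_r 1)) (pth_1 _ _ p))
    (eq_trans (f_equal p (Rminus_diag_eq 1 1 eq_refl)) (pth_0 _ _ p)).

Lemma seg_cont G a b : cR G -> cR (fun s => G (a + (b - a) * s)).
Proof. intros H. apply (cR_comp G (fun s => a + (b - a) * s)); [exact H|rc2]. Qed.

Lemma seg_0 (G : R -> X) a b x : G a = x -> G (a + (b - a) * 0) = x.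
Proof. intros <-. f_equal. lra. Qed.

Lemma seg_1 (G : R -> X) a b x : G b = x -> G (a + (b - a) * 1) = x.
Proof. intros <-. f_equal. lra. Qed.

Definition seg {x y} (G : R -> X) (HG : cR G) (a b : R) (Ha : G a = x) (Hb : G b = y) : pth x y :=
  Pth x y (fun s => G (a + (b - a) * s)) (seg_cont G a b HG) (seg_0 G a b x Ha) (seg_1 G a b y Hb).

Definition pth_rel : Type := forall x y, pth x y -> pth x y -> Prop.

(** The properties of homotopy that the argument uses and that homology shares. Reflexivity and the
    groupoid laws follow from [pc_hpt]. *)
Record path_congruence (Rl : pth_rel) : Prop := {
  pc_sym : forall x y p q, Rl x y p q -> Rl x y q p;
  pc_trans : forall x y p q r, Rl x y p q -> Rl x y q r -> Rl x y p r;
  pc_hpt : forall x y p q, hpt p q -> Rl x y p q;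
  pc_cat : forall x y z p p' q q', Rl x y p p' -> Rl y z q q' -> Rl x z (cat p q) (cat p' q') }.

Existing Class path_congruence.

Lemma hpt_cat {x y z} (p p' : pth x y) (q q' : pth y z) : hpt p p' -> hpt q q' -> hpt (cat p q) (cat p' q').
Proof.
  intros [H [C [H0 [H1 He]]]] [K [D [K0 [K1 Ke]]]].
  exists (fun s t => if Rle_dec s (1 / 2) then H (2 * s) t else K (2 * s - 1) t).
  split; [|split; [|split]].
  - apply (c2R_paste (1 / 2) (fun s t => H (2 * s) t) (fun s t => K (2 * s - 1) t)).
    + apply (c2R_comp H (fun s _ => 2 * s) (fun _ t => t)); auto; rc2.
    + apply (c2R_comp K (fun s _ => 2 * s - 1) (fun _ t => t)); auto; rc2.
    + intros t. replace (2 * (1 / 2)) with 1 by lra. replace (1 - 1) with 0 by lra.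
      destruct (He t) as [_ ->], (Ke t) as [-> _]. reflexivity.
  - intros s Hs. simpl. unfold cat_fun. destruct (Rle_dec s (1 / 2)); [apply H0|apply K0]; lra.
  - intros s Hs. simpl. unfold cat_fun. destruct (Rle_dec s (1 / 2)); [apply H1|apply K1]; lra.
  - intros t. destruct (Rle_dec 0 (1 / 2)), (Rle_dec 1 (1 / 2)); try lra. split.
    + rewrite Rmult_0_r. apply He.
    + replace (2 * 1 - 1) with 1 by lra. apply Ke.
Qed.

Lemma hpt_congruence : path_congruence (@hpt).
Proof.
  split; [exact @hpt_sym | exact @hpt_trans | auto | exact @hpt_cat].
Qed.

Lemma hpt_cat_assoc {w x y z} (p : pth w x) (q : pth x y) (r : pth y z) :
  hpt (cat (cat p q) r) (cat p (cat q r)).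
Proof.
  (* [G] runs [p], [q], [r] on consecutive unit intervals of [[0, 3]]. The two bracketings have
     breaks at 1/4, 1/2 and at 1/2, 3/4; the minimum and the maximum are the corresponding piecewise
     linear parameters. *)
  set (G := fun s => if Rle_dec s 1 then p s else if Rle_dec s 2 then q (s - 1) else r (s - 2)).
  apply straight_line_homotopy with G (fun s => Rmin (4 * s) (2 * s + 1)) (fun s => Rmax (2 * s) (4 * s - 1)).
  - apply (cR_paste 1 p (fun s => if Rle_dec s 2 then q (s - 1) else r (s - 2))).
    + apply pth_cont.
    + apply (cR_paste 2 (fun s => q (s - 1)) (fun s => r (s - 2))).
      * apply (cR_comp q (fun s => s - 1)); [apply pth_cont|rc2].
      * apply (cR_comp r (fun s => s - 2)); [apply pth_cont|rc2].
      * replace (2 - 1) with 1 by lra. replace (2 - 2) with 0 by lra. rewrite pth_1, pth_0. reflexivity.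
    + destruct (Rle_dec 1 2); [|lra]. replace (1 - 1) with 0 by lra. rewrite pth_1, pth_0. reflexivity.
  - rc2.
  - rc2.
  - unfold Rmin, Rmax. repeat destruct (Rle_dec _ _); lra.
  - unfold Rmin, Rmax. repeat destruct (Rle_dec _ _); lra.
  - intros s Hs. simpl. unfold cat_fun, G, Rmin. simpl. unfold cat_fun.
    repeat (destruct (Rle_dec _ _); try lra); f_equal; lra.
  - intros s Hs. simpl. unfold cat_fun, G, Rmax. simpl. unfold cat_fun.
    repeat (destruct (Rle_dec _ _); try lra); try (f_equal; lra).
Qed.

Lemma hpt_cst_cat {x y} (p : pth x y) : hpt (cat (cst x) p) p.
Proof.
  apply straight_line_homotopy with p (fun s => Rmax 0 (2 * s - 1)) (fun s => s); auto using pth_cont; try rc2.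
  - unfold Rmax. repeat destruct (Rle_dec _ _); lra.
  - unfold Rmax. repeat destruct (Rle_dec _ _); lra.
  - intros s Hs. simpl. unfold cat_fun, Rmax.
    repeat destruct (Rle_dec _ _); try lra; try (f_equal; lra);
      (transitivity (p 0); [symmetry; apply pth_0 | f_equal; lra]).
Qed.

Lemma hpt_cat_cst {x y} (p : pth x y) : hpt (cat p (cst y)) p.
Proof.
  apply straight_line_homotopy with p (fun s => Rmin 1 (2 * s)) (fun s => s); auto using pth_cont; try rc2.
  - unfold Rmin. repeat destruct (Rle_dec _ _); lra.
  - unfold Rmin. repeat destruct (Rle_dec _ _); lra.
  - intros s Hs. simpl. unfold cat_fun, Rmin.
    repeat destruct (Rle_dec _ _); try lra; try (f_equal; lra);
      (transitivity (p 1); [symmetry; apply pth_1 | f_equal; lra]).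
Qed.

Lemma hpt_cat_reversal {x y} (p : pth x y) : hpt (cat p (reversal p)) (cst x).
Proof.
  apply straight_line_homotopy with p (fun s => Rmin (2 * s) (2 - 2 * s)) (fun s => 0);
    auto using pth_cont; try rc2.
  - unfold Rmin. repeat destruct (Rle_dec _ _); lra.
  - unfold Rmin. repeat destruct (Rle_dec _ _); lra.
  - intros s Hs. simpl. unfold cat_fun, Rmin.
    repeat destruct (Rle_dec _ _); try lra; f_equal; lra.
  - intros s _. symmetry. apply pth_0.
Qed.

Lemma hpt_reversal_cat {x y} (p : pth x y) : hpt (cat (reversal p) p) (cst y).
Proof.
  apply straight_line_homotopy with p (fun s => Rmax (1 - 2 * s) (2 * s - 1)) (fun s => 1);
    auto using pth_cont; try rc2.
  - unfold Rmax. repeat destruct (Rle_dec _ _); lra.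
  - unfold Rmax. repeat destruct (Rle_dec _ _); lra.
  - intros s Hs. simpl. unfold cat_fun, Rmax.
    repeat destruct (Rle_dec _ _); try lra; f_equal; lra.
  - intros s _. symmetry. apply pth_1.
Qed.

Lemma hpt_seg_cat {x y z} G (HG : cR G) a b c (Ha : G a = x) (Hb : G b = y) (Hc : G c = z) :
  hpt (cat (seg G HG a b Ha Hb) (seg G HG b c Hb Hc)) (seg G HG a c Ha Hc).
Proof.
  apply straight_line_homotopy with G
    (fun s => a + (b - a) * Rmin 1 (2 * s) + (c - b) * Rmax 0 (2 * s - 1)) (fun s => a + (c - a) * s);
    auto; try rc2.
  - unfold Rmin, Rmax. repeat destruct (Rle_dec _ _); lra.
  - unfold Rmin, Rmax. repeat destruct (Rle_dec _ _); lra.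
  - intros s Hs. simpl. unfold cat_fun, Rmin, Rmax.
    repeat destruct (Rle_dec _ _); try lra; f_equal;
      first [lra | replace s with (1 / 2) by lra; lra].
Qed.

Section Congruence.
Context {Rl : pth_rel} {HR : path_congruence Rl}.

#[global] Instance pth_rel_equivalence x y : Equivalence (Rl x y).
Proof.
  split.
  - intros p. apply (pc_hpt _ HR). apply hpt_ext. auto.
  - intros p q. apply (pc_sym _ HR).
  - intros p q r. apply (pc_trans _ HR).
Qed.

#[global] Instance cat_proper x y z : Proper (Rl x y ==> Rl y z ==> Rl x z) (@cat x y z).
Proof. intros p p' Hp q q' Hq. apply (pc_cat _ HR); assumption. Qed.

Lemma rel_ext {x y} (p q : pth x y) : (forall s, 0 <= s <= 1 -> p s = q s) -> Rl x y p q.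
Proof. intros H. apply (pc_hpt _ HR), hpt_ext, H. Qed.

Lemma rel_cat_assoc {w x y z} (p : pth w x) (q : pth x y) (r : pth y z) :
  Rl w z (cat (cat p q) r) (cat p (cat q r)).
Proof. apply (pc_hpt _ HR), hpt_cat_assoc. Qed.

Lemma rel_cst_cat {x y} (p : pth x y) : Rl x y (cat (cst x) p) p.
Proof. apply (pc_hpt _ HR), hpt_cst_cat. Qed.

Lemma rel_cat_cst {x y} (p : pth x y) : Rl x y (cat p (cst y)) p.
Proof. apply (pc_hpt _ HR), hpt_cat_cst. Qed.

Lemma rel_cat_reversal {x y} (p : pth x y) : Rl x x (cat p (reversal p)) (cst x).
Proof. apply (pc_hpt _ HR), hpt_cat_reversal. Qed.

Lemma rel_reversal_cat {x y} (p : pth x y) : Rl y y (cat (reversal p) p) (cst y).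
Proof. apply (pc_hpt _ HR), hpt_reversal_cat. Qed.

Lemma rel_cancel_l {x y z} (p : pth x y) (q r : pth y z) : Rl x z (cat p q) (cat p r) -> Rl y z q r.
Proof.
  intros H. rewrite <- (rel_cst_cat q), <- (rel_cst_cat r), <- (rel_reversal_cat p).
  rewrite !rel_cat_assoc, H. reflexivity.
Qed.

Lemma rel_cancel_r {x y z} (p q : pth x y) (r : pth y z) : Rl x z (cat p r) (cat q r) -> Rl x y p q.
Proof.
  intros H. rewrite <- (rel_cat_cst p), <- (rel_cat_cst q), <- (rel_cat_reversal r).
  rewrite <- !rel_cat_assoc, H. reflexivity.
Qed.
End Congruence.
End Paths.

Arguments rel_ext {X d Hm Rl HR x y} p q.
Arguments rel_cat_assoc {X d Hm Rl HR w x y z} p q r.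
Arguments rel_cst_cat {X d Hm Rl HR x y} p.
Arguments rel_cat_cst {X d Hm Rl HR x y} p.
Arguments rel_cat_reversal {X d Hm Rl HR x y} p.
Arguments rel_reversal_cat {X d Hm Rl HR x y} p.
Arguments rel_cancel_l {X d Hm Rl HR x y z} p q r.
Arguments rel_cancel_r {X d Hm Rl HR x y z} p q r.
Arguments pc_hpt {X d Hm Rl _ x y}.
Arguments pc_cat {X d Hm Rl _ x y z}.
Arguments seg {X d x y}.

(** * Local triviality and countably many classes *)

Definition clampI (t : R) : I01 := exist _ (clamp t) (clamp_range t).

Section LocalTriviality.
Context {X : Type} (d : X -> X -> R) (Hm : is_metric d).
Local Notation cst := (cst d Hm).
Local Notation cat := (cat d Hm).
Local Notation pth := (pth d).
Local Notation reversal := (reversal d).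

Lemma cR_clampI (g : I01 -> X) : cont1 d g -> cR d (fun t => g (clampI t)).
Proof.
  intros Hg t eps He. destruct (Hg (clampI t) eps He) as [e [P K]]. exists e. split; [exact P|].
  intros s Hs. apply K. simpl. pose proof (clamp_lipschitz s t). lra.
Qed.

Lemma clampI_0 : clampI 0 = i0.
Proof. apply eq_sig_hprop; [intros; apply proof_irrelevance|]. simpl. apply clamp_id. lra. Qed.

Lemma clampI_1 : clampI 1 = i1.
Proof. apply eq_sig_hprop; [intros; apply proof_irrelevance|]. simpl. apply clamp_id. lra. Qed.

Lemma clampI_proj (t : I01) : clampI (proj1_sig t) = t.
Proof.
  apply eq_sig_hprop; [intros; apply proof_irrelevance|]. apply clamp_id. apply (proj2_sig t).
Qed.

Definition pth_of_I01 {x y} (g : I01 -> X) (Hg : cont1 d g) (H0 : g i0 = x) (H1 : g i1 = y) : pth x y :=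
  Pth d x y (fun t => g (clampI t)) (cR_clampI g Hg)
    (eq_trans (f_equal g clampI_0) H0) (eq_trans (f_equal g clampI_1) H1).

Definition path_in {x y} (V : X -> Prop) (p : pth x y) : Prop := forall t, 0 <= t <= 1 -> V (pf d p t).

Lemma path_in_cat {x y z} V (p : pth x y) (q : pth y z) : path_in V p -> path_in V q -> path_in V (cat p q).
Proof.
  intros Hp Hq t Ht. simpl. unfold cat_fun. destruct (Rle_dec t (1 / 2)); [apply Hp|apply Hq]; lra.
Qed.

Lemma path_in_reversal {x y} V (p : pth x y) : path_in V p -> path_in V (reversal p).
Proof. intros Hp t Ht. apply Hp. lra. Qed.

Lemma open_ball (x : X) r : is_open d (fun y => d x y < r).
Proof.
  intros y Hy. exists (r - d x y). split; [lra|]. intros z Hz.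
  pose proof (dist_tri d Hm x y z). lra.
Qed.

Context (Hsep : separable d) (Hconn : connected d) (Hlpc : locally_path_connected d).

Lemma lpc_nbhd x U : is_open d U -> U x -> exists V, is_open d V /\ V x /\ (forall y, V y -> U y) /\
  forall y z, V y -> V z -> exists p : pth y z, path_in V p.
Proof.
  intros HU Hx. destruct (Hlpc x U HU Hx) as [V [HV [Vx [VU P]]]].
  exists V. repeat split; auto. intros y z Hy Hz.
  destruct (P y z Hy Hz) as [g [Cg [H0 [H1 Hg]]]].
  exists (pth_of_I01 g Cg H0 H1). intros t _. apply Hg.
Qed.

Lemma path_connected (x y : X) : exists p : pth x y, True.
Proof.
  assert (C : forall z, exists V, is_open d V /\ V z /\
    forall y z, V y -> V z -> exists p : pth y z, path_in V p).
  { intros z. destruct (lpc_nbhd z (fun _ => True)) as [V [O [Vz [_ P]]]]; [|auto|eauto].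
    intros w _. exists 1. split; [lra|auto]. }
  destruct Hconn as [_ H].
  destruct (H (fun y => exists p : pth x y, True) (fun y => ~ exists p : pth x y, True)) as [N|N].
  - intros z [p _]. destruct (C z) as [V [O [Vz P]]]. destruct (O z Vz) as [e [He K]].
    exists e. split; [exact He|]. intros w Hw. destruct (P z w Vz (K w Hw)) as [q _].
    exists (cat p q). auto.
  - intros z Np. destruct (C z) as [V [O [Vz P]]]. destruct (O z Vz) as [e [He K]].
    exists e. split; [exact He|]. intros w Hw [p _]. apply Np.
    destruct (P w z (K w Hw) Vz) as [q _]. exists (cat p q). auto.
  - intros z. apply classic.
  - tauto.
  - exfalso. apply (N x). exists (cst x). auto.
  - apply NNPP, N.
Qed.

Context (Rl : pth_rel d) (HR : path_congruence d Hm Rl).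
#[local] Existing Instance pth_rel_equivalence.
#[local] Existing Instance cat_proper.

(** For homotopy this is semilocal simple connectedness: small loops become trivial in the whole
    space, not necessarily near [x]. *)
Definition semilocally_trivial : Prop := forall x, exists eps, 0 < eps /\
  forall p : pth x x, path_in (fun y => d x y < eps) p -> Rl x x p (cst x).

Definition good_set (V : X -> Prop) : Prop :=
  is_open d V /\ (forall y z, V y -> V z -> exists p : pth y z, path_in V p) /\
  forall y z (p q : pth y z), path_in V p -> path_in V q -> Rl y z p q.

Lemma good_nbhd : semilocally_trivial -> forall x, exists V, good_set V /\ V x.
Proof.
  intros S x. destruct (S x) as [e [He T]].
  destruct (lpc_nbhd x (fun y => d x y < e)) as [V [O [Vx [VU P]]]].
  { apply open_ball. }
  { rewrite (dist_refl d Hm). exact He. }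
  exists V. split; [|exact Vx]. split; [exact O|]. split; [exact P|].
  intros y z p q Hp Hq.
  assert (Vy : V y) by (rewrite <- (pth_0 d _ _ p); apply Hp; lra).
  (* The loop at [x] that follows [c] and [p] and returns along [q] and [c] stays in [V], so it is
     trivial; cancelling gives the claim. *)
  destruct (P x y Vx Vy) as [c Hc].
  apply (rel_cancel_l c), (rel_cancel_r _ _ (reversal (cat c q))).
  rewrite (rel_cat_reversal (cat c q)).
  apply T. intros t Ht. apply VU. revert t Ht.
  apply (path_in_cat V); [|apply (path_in_reversal V)]; apply (path_in_cat V); assumption.
Qed.

(** A Lindelof argument: for each of the countably many balls with centre in the dense sequence and
    radius [1 / (k + 1)], one good set containing the ball is chosen if there is any. *)
Lemma good_cover : semilocally_trivial ->
  exists V : nat -> X -> Prop, (forall j, good_set (V j)) /\ forall x, exists j, V j x.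
Proof.
  intros S. destruct Hsep as [s Hs].
  assert (C : forall j, exists V, good_set V /\
    forall W, good_set W -> (forall y, d (s (fst (of_nat j))) y < / INR (Datatypes.S (snd (of_nat j))) -> W y) ->
    forall y, d (s (fst (of_nat j))) y < / INR (Datatypes.S (snd (of_nat j))) -> V y).
  { intros j. destruct (classic (exists W, good_set W /\
      forall y, d (s (fst (of_nat j))) y < / INR (Datatypes.S (snd (of_nat j))) -> W y)) as [[W [G HW]]|N].
    - exists W. auto.
    (* The empty set is vacuously good and serves as the default. *)
    - exists (fun _ => False). split; [|intros W G HW; exfalso; eauto].
      split; [|split].
      + intros x [].
      + intros y z [].
      + intros y z p q Hp. destruct (Hp 0). lra. }
  apply functional_choice in C. destruct C as [V HV].
  exists V. split; [intros j; apply HV|].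
  intros x. destruct (good_nbhd S x) as [W [G Wx]].
  destruct (proj1 G x Wx) as [e [He K]].
  destruct (archimed_cor1 (e / 2)) as [k [Hk Hk0]]; [lra|].
  destruct k as [|k]; [lia|].
  destruct (Hs x (/ INR (Datatypes.S k))) as [m Hmx]; [apply Rinv_0_lt_compat, lt_0_INR; lia|].
  exists (to_nat (m, k)). destruct (HV (to_nat (m, k))) as [_ B]. rewrite cancel_of_to in B.
  simpl fst in B; simpl snd in B.
  apply (B W G).
  - intros y Hy. apply K. pose proof (dist_tri d Hm x (s m) y). lra.
  - rewrite (dist_sym d Hm). exact Hmx.
Qed.

Lemma lebesgue_number_path (g : R -> X) (V : nat -> X -> Prop) :
  cR d g -> (forall j, is_open d (V j)) -> (forall x, exists j, V j x) ->
  exists n, (0 < n)%nat /\ forall i, (i < n)%nat -> exists j, forall t,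
    INR i / INR n <= t <= INR (S i) / INR n -> V j (g t).
Proof.
  intros Hg HV HC.
  (* The radius is doubled because compactness puts each [t] within [delta u] of some [u] with
     [delta u >= e]; an interval of length below [e] starting at [t] then stays within [2 * delta u]
     of [u]. *)
  assert (D : forall t, exists e : posreal, exists j, forall s, Rabs (s - t) < 2 * e -> V j (g s)).
  { intros t. destruct (HC (g t)) as [j Hj]. destruct (HV j _ Hj) as [r [Pr Kr]].
    destruct (Hg t r Pr) as [e [Pe Ke]].
    assert (P : 0 < e / 2) by lra. exists (mkposreal _ P), j. intros s Hs. simpl in Hs.
    apply Kr. rewrite (dist_sym d Hm). apply Ke. lra. }
  apply functional_choice in D. destruct D as [delta HD].
  destruct (compactness_value_1d 0 1 delta) as [e He].
  destruct (archimed_cor1 e (cond_pos e)) as [n [Hn Pn]].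
  exists n. split; [exact Pn|]. intros i Hi.
  assert (P : 0 < INR n) by (apply lt_0_INR; exact Pn).
  assert (Hin : 0 <= INR i / INR n <= 1).
  { split.
    - apply Rmult_le_pos; [apply pos_INR|]. left. apply Rinv_0_lt_compat, P.
    - apply Rmult_le_reg_r with (INR n); [exact P|]. unfold Rdiv. rewrite Rmult_assoc, Rinv_l by lra.
      rewrite Rmult_1_l, Rmult_1_r. apply le_INR. lia. }
  specialize (He _ Hin). apply NNPP in He. destruct He as [u [_ [Hu Hd]]].
  destruct (HD u) as [j Hj]. exists j. intros t Ht. apply Hj.
  rewrite S_INR in Ht. unfold Rdiv in Ht, Hu. rewrite Rmult_plus_distr_r in Ht.
  revert Hu. unfold Rabs. destruct (Rcase_abs _), (Rcase_abs _); lra.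
Qed.

Lemma countably_many_classes (x0 : X) : semilocally_trivial ->
  exists F : nat -> pth x0 x0, forall g, exists n, Rl x0 x0 g (F n).
Proof.
  intros S. destruct (good_cover S) as [V [HV HC]]. destruct Hsep as [s Hs].
  (* Index 0 is the base point, so that words start there and a loop is recognised by ending at
     index 0. *)
  set (pts := fun n => match n with O => x0 | Datatypes.S n => s n end).
  assert (dense : forall x eps, 0 < eps -> exists n, d x (pts n) < eps).
  { intros x eps He. destruct (Hs x eps He) as [n Hn]. exists (Datatypes.S n). exact Hn. }
  assert (edge : forall t : nat * nat * nat, exists e : pth (pts (fst (fst t))) (pts (snd t)),
    V (snd (fst t)) (pts (fst (fst t))) -> V (snd (fst t)) (pts (snd t)) -> path_in (V (snd (fst t))) e).
  { intros [[m j] m']. simpl. destruct (classic (V j (pts m) /\ V j (pts m'))) as [[A B]|N].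
    - destruct (HV j) as [_ [P _]]. destruct (P _ _ A B) as [e He]. exists e. auto.
    - destruct (path_connected (pts m) (pts m')) as [e _]. exists e. tauto. }
  set (e := fun m j m' => proj1_sig (constructive_indefinite_description _ (edge (m, j, m')))).
  assert (He : forall m j m', V j (pts m) -> V j (pts m') -> path_in (V j) (e m j m')) by
    (intros m j m'; exact (proj2_sig (constructive_indefinite_description _ (edge (m, j, m'))))).
  clearbody e.
  (* A word is read from its tail: each letter [(j, m')] appends the chosen edge through [V j] to
     the point [m']. The varying end point forces a dependent pair. *)
  set (word := fix word (l : list (nat * nat)) : {m : nat & pth x0 (pts m)} := match l with
    | nil => existT _ 0%nat (cst x0)
    | (j, m') :: l => let (m, p) := word l in existT _ m' (cat p (e m j m'))
    end).
  assert (P : forall g : pth x0 x0, exists l, exists p : pth x0 x0,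
    word l = existT _ 0%nat p /\ Rl x0 x0 g p).
  { intros g.
    destruct (lebesgue_number_path (pf d g) V (pth_cont d _ _ g)) as [n [Hn0 Hn]];
      [intros j; apply HV|exact HC|].
    assert (Pn : 0 < INR n) by (apply lt_0_INR; exact Hn0).
    set (sg := fun t => seg (pf d g) (pth_cont d _ _ g) 0 t (pth_0 d _ _ g) eq_refl).
    (* The point [g (i/n)] need not belong to the dense sequence, so the induction ranges over all
       paths [c] that connect it to the sequence inside a set of the cover. *)
    assert (I : forall i, (i <= n)%nat -> forall j m (c : pth (pf d g (INR i / INR n)) (pts m)),
      path_in (V j) c -> exists l p, word l = existT _ m p /\
      Rl x0 (pts m) (cat (sg (INR i / INR n)) c) p).
    { induction i as [|i IH]; intros Hi j' m' c Hc.
      - assert (E : INR 0 / INR n = 0) by (simpl; lra).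
        generalize dependent (INR 0 / INR n). intros r c Hc ->.
        exists ((j', m') :: nil), (cat (cst x0) (e 0%nat j' m')). split; [reflexivity|].
        assert (Hx : pf d g 0 = x0) by apply pth_0.
        assert (V0 : V j' x0).
        { rewrite <- Hx, <- (pth_0 d _ _ c). apply Hc. lra. }
        assert (Vm : V j' (pts m')) by (rewrite <- (pth_1 d _ _ c); apply Hc; lra).
        (* This is [c] with its start retyped from [pf d g 0] to [x0]. *)
        set (c' := Pth d x0 (pts m') (pf d c) (pth_cont d _ _ c)
          (eq_trans (pth_0 d _ _ c) Hx) (pth_1 d _ _ c)).
        transitivity (cat (cst x0) c').
        + apply rel_ext. intros t Ht. simpl. unfold cat_fun.
          destruct (Rle_dec t (1 / 2)); [|reflexivity].
          transitivity (pf d g 0); [f_equal; lra|apply pth_0].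
        + apply pc_cat; [reflexivity|]. apply (HV j'); [exact Hc|].
          apply (He 0%nat j' m'); assumption.
      - destruct (Hn i) as [j Hj]; [lia|].
        set (a := INR i / INR n) in *. set (b := INR (Datatypes.S i) / INR n) in *.
        assert (ab : a <= b).
        { apply Rmult_le_compat_r; [left; apply Rinv_0_lt_compat, Pn|apply le_INR; lia]. }
        assert (Va : V j (pf d g a)) by (apply Hj; lra).
        assert (Vb : V j (pf d g b)) by (apply Hj; lra).
        assert (Vb' : V j' (pf d g b)) by (rewrite <- (pth_0 d _ _ c); apply Hc; lra).
        destruct (proj1 (HV j) _ Va) as [r [Pr Kr]].
        destruct (dense (pf d g a) r Pr) as [m Hmr].
        destruct (proj1 (proj2 (HV j)) _ (pts m) Va (Kr _ Hmr)) as [c1 Hc1].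
        destruct (IH ltac:(lia) j m c1 Hc1) as [l [p [Hl Hp]]].
        (* The new point [m1] must lie in both [V j] and [V j'] and be joined to [g b] inside both.
           Up to connecting paths, the edge from [m] to [m1] then replaces [g] between [a] and [b],
           and the edge from [m1] to [m'] replaces [c]. *)
        destruct (lpc_nbhd (pf d g b) (fun y => V j y /\ V j' y)) as [W [OW [Wb [WV PW]]]].
        { intros y [Y1 Y2]. destruct (proj1 (HV j) y Y1) as [r1 [R1 K1]].
          destruct (proj1 (HV j') y Y2) as [r2 [R2 K2]].
          exists (Rmin r1 r2). split; [apply Rmin_pos; assumption|]. intros z Hz.
          pose proof (Rmin_l r1 r2). pose proof (Rmin_r r1 r2).
          split; [apply K1|apply K2]; lra. }
        { auto. }
        destruct (OW _ Wb) as [r' [Pr' Kr']].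
        destruct (dense (pf d g b) r' Pr') as [m1 Hm1].
        destruct (PW _ (pts m1) Wb (Kr' _ Hm1)) as [c2 Hc2].
        assert (Vm : V j (pts m)) by auto.
        assert (Vm1 : V j (pts m1)) by (apply WV; auto).
        assert (Vm1' : V j' (pts m1)) by (apply WV; auto).
        assert (Vm' : V j' (pts m')) by (rewrite <- (pth_1 d _ _ c); apply Hc; lra).
        exists ((j', m') :: (j, m1) :: l), (cat (cat p (e m j m1)) (e m1 j' m')).
        split; [simpl; rewrite Hl; reflexivity|].
        assert (E1 : Rl _ _ (cat (reversal c1)
          (cat (seg (pf d g) (pth_cont d _ _ g) a b eq_refl eq_refl) c2)) (e m j m1)).
        { apply (HV j); [|apply He; assumption].
          apply path_in_cat; [apply path_in_reversal, Hc1|].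
          apply path_in_cat; [|intros t Ht; apply WV, Hc2, Ht].
          intros t Ht. apply Hj. simpl. nra. }
        assert (E2 : Rl _ _ (cat (reversal c2) c) (e m1 j' m')).
        { apply (HV j'); [|apply He; assumption].
          apply path_in_cat; [apply path_in_reversal; intros t Ht; apply WV, Hc2, Ht|exact Hc]. }
        rewrite <- Hp, <- E1, <- E2.
        rewrite !rel_cat_assoc.
        rewrite <- (rel_cat_assoc c1 (reversal c1)), (rel_cat_reversal c1),
          rel_cst_cat.
        rewrite <- (rel_cat_assoc c2 (reversal c2)), (rel_cat_reversal c2),
          rel_cst_cat.
        rewrite <- (rel_cat_assoc (sg a)).
        apply pc_cat; [|reflexivity]. symmetry.
        apply pc_hpt, hpt_seg_cat. }
    specialize (I n (le_n n)). replace (INR n / INR n) with 1 in I by (field; lra).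
    destruct (HC x0) as [j Hj].
    destruct (I j 0%nat (Pth d (pf d g 1) x0 (fun _ => x0) (cR_const d Hm x0)
      (eq_sym (pth_1 d _ _ g)) eq_refl)) as [l [p [Hl Hp]]]; [intros t _; exact Hj|].
    exists l, p. split; [exact Hl|]. rewrite <- Hp.
    transitivity (cat g (cst x0)); [symmetry; apply rel_cat_cst|].
    apply rel_ext. intros t Ht. simpl. unfold cat_fun.
    destruct (Rle_dec t (1 / 2)); [|reflexivity]. f_equal. lra. }
  destruct (countable_list (nat * nat) (countable_prod _ _ countable_nat countable_nat)) as [dec Hdec].
  (* A word ending at another index does not have the type of a loop at [x0]; the constant loop is
     the default for it. *)
  exists (fun n => match word (dec n) with
    | existT O p => p
    | _ => cst x0
    end).
  intros g. destruct (P g) as [l [p [Hl Hp]]]. destruct (Hdec l) as [n <-].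
  exists n. rewrite Hl. exact Hp.
Qed.
End LocalTriviality.

(** * Infinite concatenations of small loops *)

Section BumpLoops.
Context {X : Type} (d : X -> X -> R) (Hm : is_metric d).
Local Notation cst := (cst d Hm).
Local Notation cat := (cat d Hm).
Local Notation pth := (pth d).
Local Notation reversal := (reversal d).

Context (x : X) (f : nat -> pth x x)
  (f_small : forall n, path_in d (fun y => d x y < / INR (S n)) (f n)).

Definition bump_start (n : nat) : R := 1 - / INR (S n).

Lemma bump_start_0 : bump_start 0 = 0.
Proof. unfold bump_start. simpl. lra. Qed.

Lemma bump_start_lt1 n : bump_start n < 1.
Proof.
  unfold bump_start. assert (0 < / INR (S n)); [|lra].
  apply Rinv_0_lt_compat, lt_0_INR; lia.
Qed.

Lemma bump_start_lt n : bump_start n < bump_start (S n).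
Proof.
  unfold bump_start. assert (/ INR (S (S n)) < / INR (S n)); [|lra].
  apply Rinv_lt_contravar; [|apply lt_INR; lia].
  apply Rmult_lt_0_compat; apply lt_0_INR; lia.
Qed.

Lemma bump_start_mono n m : (n <= m)%nat -> bump_start n <= bump_start m.
Proof.
  induction 1 as [|m _ IH]; [lra|]. pose proof (bump_start_lt m). lra.
Qed.

(** The clamp keeps the loop at [x] outside its interval, so that every bump is defined and
    continuous on the whole line. *)
Definition bump (n : nat) (s : R) : X :=
  pf d (f n) (clamp ((s - bump_start n) * / (bump_start (S n) - bump_start n))).

Lemma bump_cont n : cR d (bump n).
Proof.
  apply (cR_comp d (pf d (f n))
    (fun s => clamp ((s - bump_start n) * / (bump_start (S n) - bump_start n)))).
  - apply pth_cont.
  - apply (rc2_clamp (fun s _ => (s - bump_start n) * / (bump_start (S n) - bump_start n))). rc2.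
Qed.

Lemma bump_small n s : d x (bump n s) < / INR (S n).
Proof. apply f_small, clamp_range. Qed.

Lemma bump_support n s : bump n s <> x -> bump_start n < s < bump_start (S n).
Proof.
  pose proof (bump_start_lt n) as L.
  assert (P : 0 < / (bump_start (S n) - bump_start n)) by (apply Rinv_0_lt_compat; lra).
  intros H. split; apply Rnot_le_lt; intros K; apply H; unfold bump.
  - transitivity (pf d (f n) 0); [f_equal|apply pth_0].
    unfold clamp. rewrite Rmax_left; [reflexivity|].
    apply Rle_trans with ((s - bump_start n) * / (bump_start (S n) - bump_start n)); [apply Rmin_r|]. nra.
  - transitivity (pf d (f n) 1); [f_equal|apply pth_1].
    unfold clamp. rewrite Rmin_left; [apply Rmax_right; lra|].
    apply Rmult_le_reg_r with (bump_start (S n) - bump_start n); [lra|].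
    rewrite Rmult_assoc, Rinv_l by lra. lra.
Qed.

Lemma bump_disjoint n m s : bump n s <> x -> bump m s <> x -> n = m.
Proof.
  intros Hn%bump_support Hm'%bump_support.
  destruct (Nat.lt_trichotomy n m) as [L|[E|L]]; [|exact E|]; exfalso.
  - pose proof (bump_start_mono (S n) m L). lra.
  - pose proof (bump_start_mono (S m) n L). lra.
Qed.

(* The infinite concatenation of the loops [f n] with [a n = true]; the [n]-th one is run
   through on the interval from [bump_start n] to [bump_start (S n)]. *)
Definition bumps (a : nat -> bool) (s : R) : X :=
  match excluded_middle_informative (exists n, a n = true /\ bump n s <> x) with
  | left H => bump (proj1_sig (constructive_indefinite_description _ H)) s
  | right _ => x
  end.

Lemma bumps_spec a s :
  (bumps a s = x /\ forall n, a n = true -> bump n s = x) \/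
  exists n, a n = true /\ bump n s <> x /\ bumps a s = bump n s.
Proof.
  unfold bumps. destruct (excluded_middle_informative _) as [H|H].
  - right. destruct (constructive_indefinite_description _ H) as [n [A B]]. simpl. eauto.
  - left. split; [reflexivity|]. intros n Hn. apply NNPP. intros K. eauto.
Qed.

(** For large [n] both values lie within [1 / (n + 1)] of [x]; the finitely many other bumps are
    handled by their continuity. *)
Lemma bump_equicontinuous s0 eps : 0 < eps -> exists delta, 0 < delta /\
  forall s, Rabs (s - s0) < delta -> forall n, d (bump n s) (bump n s0) < eps.
Proof.
  intros He. destruct (archimed_cor1 (eps / 2)) as [N [HN PN]]; [lra|].
  assert (K : forall M, exists delta, 0 < delta /\
    forall s, Rabs (s - s0) < delta -> forall n, (n < M)%nat -> d (bump n s) (bump n s0) < eps).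
  { induction M as [|M [e [P IH]]]; [exists 1; split; [lra|]; intros; lia|].
    destruct (bump_cont M s0 eps He) as [e' [P' IH']].
    exists (Rmin e e'). split; [apply Rmin_pos; assumption|].
    intros s Hs n Hn. pose proof (Rmin_l e e'). pose proof (Rmin_r e e').
    destruct (Nat.eq_dec n M) as [->|Hne]; [apply IH'; lra|]. apply IH; [lra|lia]. }
  destruct (K N) as [e [P H]]. exists e. split; [exact P|]. intros s Hs n.
  destruct (Nat.lt_ge_cases n N) as [L|L]; [apply H; assumption|].
  pose proof (bump_small n s). pose proof (bump_small n s0).
  pose proof (dist_tri d Hm (bump n s) x (bump n s0)) as T.
  rewrite (dist_sym d Hm (bump n s) x) in T.
  assert (/ INR (S n) <= / INR N); [|lra].
  apply Rinv_le_contravar; [apply lt_0_INR; lia|apply le_INR; lia].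
Qed.

Lemma bumps_cont a : cR d (bumps a).
Proof.
  intros s0 eps He. destruct (bump_equicontinuous s0 (eps / 2)) as [e [P K]]; [lra|].
  exists e. split; [exact P|]. intros s Hs. specialize (K s Hs).
  destruct (bumps_spec a s) as [[-> A]|[n [A [B ->]]]], (bumps_spec a s0) as [[-> A']|[m [A' [B' ->]]]].
  - rewrite (dist_refl d Hm). exact He.
  - specialize (K m). rewrite (A m A') in K. lra.
  - specialize (K n). rewrite (A' n A) in K. lra.
  (* If different bumps are active at [s] and [s0], each of them is at [x] at the other parameter,
     so the distance is estimated through [x]. *)
  - destruct (Nat.eq_dec n m) as [->|Hne]; [specialize (K m); lra|].
    assert (E1 : bump n s0 = x) by (apply NNPP; intros H; apply Hne; eapply bump_disjoint; eauto).
    assert (E2 : bump m s = x) by (apply NNPP; intros H; apply Hne; eapply bump_disjoint; eauto).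
    pose proof (K n) as Kn. pose proof (K m) as Km. rewrite E1 in Kn. rewrite E2 in Km.
    pose proof (dist_tri d Hm (bump n s) x (bump m s0)). lra.
Qed.

Lemma bumps_off a s : (forall n, bump n s = x) -> bumps a s = x.
Proof. intros H. destruct (bumps_spec a s) as [[E _]|[n [_ [N _]]]]; [exact E|]. destruct (N (H n)). Qed.

Lemma bumps_start a n : bumps a (bump_start n) = x.
Proof.
  apply bumps_off. intros m. apply NNPP. intros H%bump_support.
  destruct (Nat.le_gt_cases n m) as [L|L].
  - pose proof (bump_start_mono n m L). lra.
  - pose proof (bump_start_mono (S m) n L). lra.
Qed.

Lemma bumps_0 a : bumps a 0 = x.
Proof. rewrite <- bump_start_0. apply bumps_start. Qed.

Lemma bumps_1 a : bumps a 1 = x.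
Proof.
  apply bumps_off. intros m. apply NNPP. intros H%bump_support.
  pose proof (bump_start_lt1 (S m)). lra.
Qed.

Definition bump_loop (a : nat -> bool) : pth x x := Pth d x x (bumps a) (bumps_cont a) (bumps_0 a) (bumps_1 a).

(** Bumps of index below [N] are common to both loops, and the others stay within [1 / (N + 1)] of
    [x]. Hence the loop depends continuously on the sequence in the uniform metric. *)
Lemma bumps_near N a b s : agree N a b -> d (bumps a s) (bumps b s) < 2 * / INR (S N).
Proof.
  intros H. assert (P : 0 < / INR (S N)) by (apply Rinv_0_lt_compat, lt_0_INR; lia).
  assert (Hd : forall n, (N <= n)%nat -> / INR (S n) <= / INR (S N)).
  { intros n L. apply Rinv_le_contravar; [apply lt_0_INR; lia|apply le_INR; lia]. }
  destruct (classic (exists n, (n < N)%nat /\ bump n s <> x)) as [[n [L B]]|K].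
  - assert (E : bumps a s = bumps b s); [|rewrite E, (dist_refl d Hm); lra].
    assert (Q : forall c, bumps c s = if c n then bump n s else x).
    { intros c. destruct (bumps_spec c s) as [[-> A]|[m [A [B' ->]]]].
      - destruct (c n) eqn:Ec; [|reflexivity]. symmetry. auto.
      - rewrite (bump_disjoint m n s B' B) in *. rewrite A. reflexivity. }
    rewrite !Q, (H n L). reflexivity.
  - assert (Q : forall c, d x (bumps c s) < / INR (S N)).
    { intros c. destruct (bumps_spec c s) as [[-> A]|[m [A [B ->]]]]; [rewrite (dist_refl d Hm); exact P|].
      destruct (Nat.lt_ge_cases m N) as [L|L]; [exfalso; eauto|].
      pose proof (bump_small m s). specialize (Hd m L). lra. }
    pose proof (dist_tri d Hm (bumps a s) x (bumps b s)) as T.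
    rewrite (dist_sym d Hm (bumps a s) x) in T. pose proof (Q a). pose proof (Q b). lra.
Qed.

Lemma bumps_at a n s : bump_start n <= s <= bump_start (S n) -> bumps a s = if a n then bump n s else x.
Proof.
  intros Hs. destruct (bumps_spec a s) as [[-> A]|[m [A [B ->]]]].
  - destruct (a n) eqn:E; [symmetry; auto|reflexivity].
  - pose proof (bump_support m s B) as K.
    destruct (Nat.lt_trichotomy m n) as [L|[->|L]].
    + pose proof (bump_start_mono (S m) n L). lra.
    + rewrite A. reflexivity.
    + pose proof (bump_start_mono (S n) m L). lra.
Qed.

Lemma bumps_flip a n s : ~ bump_start n < s < bump_start (S n) -> bumps a s = bumps (flip n a) s.
Proof.
  intros N. assert (Q : forall m, m <> n -> flip n a m = a m).
  { intros m Hne. unfold flip. destruct (Nat.eqb_spec m n); tauto. }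
  assert (B : forall m, bump m s <> x -> m <> n).
  { intros m H ->. apply N, bump_support, H. }
  destruct (bumps_spec a s) as [[E A]|[m [A [Bm E]]]], (bumps_spec (flip n a) s) as [[E' A']|[m' [A' [Bm' E']]]];
    rewrite E, E'.
  - reflexivity.
  - rewrite Q in A' by auto. symmetry. auto.
  - rewrite <- Q in A by auto. auto.
  - rewrite (bump_disjoint m m' s); auto.
Qed.

Context {Rl : pth_rel d} {HR : path_congruence d Hm Rl}.
#[local] Existing Instance pth_rel_equivalence.
#[local] Existing Instance cat_proper.

(** The two loops coincide outside the [n]-th interval. Cut into three pieces, their outer pieces
    cancel, and the middle ones are [f n] and the constant loop. *)
Lemma bump_loop_flip_on a n : a n = true ->
  Rl x x (bump_loop a) (bump_loop (flip n a)) -> Rl x x (f n) (cst x).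
Proof.
  intros Ha H. pose proof (bump_start_lt n) as L. pose proof (bump_start_lt1 (S n)) as L1.
  assert (L0 : 0 <= bump_start n) by (rewrite <- bump_start_0; apply bump_start_mono; lia).
  set (piece := fun c u v (Hu : bumps c u = x) (Hv : bumps c v = x) => seg (bumps c) (bumps_cont c) u v Hu Hv).
  assert (split3 : forall c, Rl x x (bump_loop c)
    (cat (cat (piece c 0 (bump_start n) (bumps_0 c) (bumps_start c n))
              (piece c (bump_start n) (bump_start (S n)) (bumps_start c n) (bumps_start c (S n))))
         (piece c (bump_start (S n)) 1 (bumps_start c (S n)) (bumps_1 c)))).
  { intros c. unfold piece.
    rewrite (pc_hpt _ _ (hpt_seg_cat d Hm (bumps c) (bumps_cont c) 0 _ _ _ _ _)).
    rewrite (pc_hpt _ _ (hpt_seg_cat d Hm (bumps c) (bumps_cont c) 0 _ _ _ _ _)).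
    apply rel_ext. intros s Hs. simpl. f_equal. lra. }
  rewrite (split3 a), (split3 (flip n a)) in H.
  assert (E1 : Rl x x (piece a 0 (bump_start n) (bumps_0 a) (bumps_start a n))
    (piece (flip n a) 0 (bump_start n) (bumps_0 _) (bumps_start _ n))).
  { apply rel_ext. intros s Hs. apply bumps_flip. nra. }
  assert (E2 : Rl x x (piece a (bump_start (S n)) 1 (bumps_start a (S n)) (bumps_1 a))
    (piece (flip n a) (bump_start (S n)) 1 (bumps_start _ (S n)) (bumps_1 _))).
  { apply rel_ext. intros s Hs. apply bumps_flip. nra. }
  rewrite E1, E2 in H. apply rel_cancel_r, rel_cancel_l in H.
  assert (range : forall s, 0 <= s <= 1 ->
    bump_start n <= bump_start n + (bump_start (S n) - bump_start n) * s <= bump_start (S n)) by (intros; nra).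
  etransitivity; [|etransitivity; [exact H|]].
  - apply rel_ext. intros s Hs. simpl. rewrite (bumps_at a n), Ha by auto. unfold bump. f_equal.
    rewrite <- (clamp_id s Hs) at 1. f_equal. field. lra.
  - apply rel_ext. intros s Hs. simpl. rewrite (bumps_at _ n) by auto.
    unfold flip. rewrite Nat.eqb_refl, Ha. reflexivity.
Qed.

Lemma bump_loop_flip a n : Rl x x (bump_loop a) (bump_loop (flip n a)) -> Rl x x (f n) (cst x).
Proof.
  destruct (a n) eqn:E; [apply bump_loop_flip_on, E|].
  intros H. apply (bump_loop_flip_on (flip n a)).
  - unfold flip. rewrite Nat.eqb_refl, E. reflexivity.
  - rewrite flip_flip. symmetry. exact H.
Qed.
End BumpLoops.

(** * The dichotomy for analytic path congruences *)

Section Dichotomy.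
Context {X : Type} (d : X -> X -> R) (Hm : is_metric d).
Local Notation cst := (cst d Hm).
Local Notation cat := (cat d Hm).
Local Notation pth := (pth d).
Local Notation reversal := (reversal d).

Definition uniform_limit {x y} (ps : nat -> pth x y) (p : pth x y) : Prop :=
  forall eps, 0 < eps -> exists N, forall n, (N <= n)%nat -> forall t, 0 <= t <= 1 ->
    d (pf d (ps n) t) (pf d p t) < eps.

(* The relation is a projection of a closed set along a space [W] of witnesses; the sets
   [cov n k] (for fixed [n]) cover [W], and choosing one for each [n] shrinks to a point. *)
Definition analytic_rel (Rl : pth_rel d) : Prop := forall x,
  exists (W : Type) (C : pth x x -> pth x x -> W -> Prop) (cov : nat -> nat -> W -> Prop),
    (forall p q, Rl x x p q -> exists w, C p q w) /\
    (forall p q w, C p q w -> forall n, exists k, cov n k w) /\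
    (forall p q ps qs ws k, uniform_limit ps p -> uniform_limit qs q ->
      (forall n, C (ps n) (qs n) (ws n)) ->
      (forall n m, (m < n)%nat -> cov m (k m) (ws n)) -> Rl x x p q).

Context {Rl : pth_rel d} {HR : path_congruence d Hm Rl}.
#[local] Existing Instance pth_rel_equivalence.
#[local] Existing Instance cat_proper.

(** The Souslin scheme has at node [s] the pairs with a witness in the sets [cov] selected by [s]. A
    point in the closure along a branch comes with approximating pairs and witnesses that change
    with the stage, which is why [analytic_rel] speaks of sequences. *)
Lemma continuum_many_classes_at : analytic_rel Rl -> ~ semilocally_trivial d Hm Rl ->
  exists (x : X) (u : (nat -> bool) -> pth x x), forall a b, Rl x x (u a) (u b) -> a = b.
Proof.
  intros HA N.
  apply not_all_ex_not in N. destruct N as [x N].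
  assert (B : forall n, exists p : pth x x,
    path_in d (fun y => d x y < / INR (S n)) p /\ ~ Rl x x p (cst x)).
  { intros n. apply NNPP. intros K. apply N. exists (/ INR (S n)). split.
    - apply Rinv_0_lt_compat, lt_0_INR; lia.
    - intros p Hp. apply NNPP. intros Hr. eauto. }
  apply functional_choice in B. destruct B as [f Hf].
  assert (f_small : forall n, path_in d (fun y => d x y < / INR (S n)) (f n)) by apply Hf.
  set (G := bump_loop d Hm x f f_small).
  destruct (HA x) as [W [C [cov [C1 [C2 C3]]]]].
  (* The latest choice is the head, so the level of a choice is the length of the list behind it. *)
  set (fits := fix fits (s : list nat) (w : W) : Prop := match s with
    | nil => True
    | k :: s => cov (length s) k w /\ fits s w
    end).
  assert (fits_branch : forall br l w, fits (branch_prefix br l) w ->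
    forall m, (m < l)%nat -> cov m (br m) w).
  { intros br l w. assert (Len : forall l, length (branch_prefix br l) = l)
      by (induction l0; simpl; congruence).
    induction l as [|l IH]; simpl; [lia|]. rewrite Len. intros [H1 H2] m Hlt.
    destruct (Nat.eq_dec m l) as [->|Hne]; [exact H1|]. apply IH; [exact H2|lia]. }
  assert (lim : forall a (as_ : nat -> nat -> bool), (forall l, agree l a (as_ l)) ->
    uniform_limit (fun l => G (as_ l)) (G a)).
  { intros a as_ H eps He. destruct (archimed_cor1 (eps / 2)) as [K [HK PK]]; [lra|].
    exists K. intros n Hn t _. rewrite (dist_sym d Hm).
    pose proof (bumps_near d Hm x f f_small n a (as_ n) t (H n)) as Q. simpl pf.
    assert (/ INR (S n) <= / INR K); [|lra].
    apply Rinv_le_contravar; [apply lt_0_INR; lia|apply le_INR; lia]. }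
  destruct (perfectly_many_classes (fun a b => Rl x x (G a) (G b))
    (fun s a b => exists w, C (G a) (G b) w /\ fits s w)) as [h Hh].
  - intros a b H. symmetry. exact H.
  - intros a b c H K. etransitivity; eassumption.
  - intros n a H. apply (bump_loop_flip d Hm x f f_small (HR := HR)) in H. apply (Hf n), H.
  - intros a b H. destruct (C1 _ _ H) as [w Hw]. exists w. simpl. auto.
  - intros s a b [w [Hw Hs]]. destruct (C2 _ _ _ Hw (length s)) as [k Hk].
    exists k, w. simpl. auto.
  - intros a b br H.
    apply functional_choice in H. destruct H as [as_ H].
    apply functional_choice in H. destruct H as [bs H].
    assert (H' : forall l, exists w, C (G (as_ l)) (G (bs l)) w /\ fits (branch_prefix br l) w) by apply H.
    apply functional_choice in H'. destruct H' as [ws H'].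
    apply (C3 _ _ (fun l => G (as_ l)) (fun l => G (bs l)) ws br).
    + apply lim. intros l. apply H.
    + apply lim. intros l. apply H.
    + intros l. apply H'.
    + intros n m L. apply (fits_branch br n); [apply H'|exact L].
  - exists x, (fun a => G (h a)). exact Hh.
Qed.

Context (Hsep : separable d) (Hconn : connected d) (Hlpc : locally_path_connected d).

Theorem countable_or_continuum_many (x0 : X) : analytic_rel Rl ->
  (exists F : nat -> pth x0 x0, forall g, exists n, Rl x0 x0 g (F n)) \/
  exists u : (nat -> bool) -> pth x0 x0, forall a b, Rl x0 x0 (u a) (u b) -> a = b.
Proof.
  intros HA. destruct (classic (semilocally_trivial d Hm Rl)) as [S|N].
  - left. apply (countably_many_classes d Hm Hsep Hconn Hlpc Rl HR x0 S).
  - right. destruct (continuum_many_classes_at HA N) as [x [u Hu]].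
    destruct (path_connected d Hm Hconn Hlpc x0 x) as [p _].
    (* Conjugation by [p] carries the family from [x] to the base point and is undone by
       cancellation. *)
    exists (fun a => cat (cat p (u a)) (reversal p)). intros a b H.
    apply rel_cancel_r, rel_cancel_l in H. apply Hu, H.
Qed.
End Dichotomy.

(** * Codes of maps on the unit square *)

Definition cell (c : nat * nat * nat) (s t : R) : Prop :=
  let '(m, i, j) := c in
  Rabs (s - INR i / INR (S m)) < / INR (S m) /\ Rabs (t - INR j / INR (S m)) < / INR (S m).

Lemma nearest_nat n s : 0 <= s <= INR n -> exists i, (i <= n)%nat /\ Rabs (s - INR i) < 1.
Proof.
  induction n as [|n IH]; intros Hs.
  - exists 0%nat. split; [lia|]. simpl in *. unfold Rabs. destruct (Rcase_abs _); lra.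
  - rewrite S_INR in Hs. destruct (Rle_dec s (INR n)) as [L|L].
    + destruct IH as [i [Hi K]]; [lra|]. exists i. split; [lia|exact K].
    + exists (S n). split; [lia|]. rewrite S_INR. unfold Rabs. destruct (Rcase_abs _); lra.
Qed.

Lemma grid_point m s : 0 <= s <= 1 ->
  exists i, (i <= S m)%nat /\ Rabs (s - INR i / INR (S m)) < / INR (S m).
Proof.
  intros Hs. assert (P : 0 < INR (S m)) by (apply lt_0_INR; lia).
  destruct (nearest_nat (S m) (s * INR (S m))) as [i [Hi K]]; [nra|].
  exists i. split; [exact Hi|].
  replace (s - INR i / INR (S m)) with ((s * INR (S m) - INR i) * / INR (S m)) by (field; lra).
  assert (Q : 0 < / INR (S m)) by (apply Rinv_0_lt_compat, P).
  rewrite Rabs_mult, (Rabs_right (/ INR (S m))) by lra.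
  rewrite <- (Rmult_1_l (/ INR (S m))) at 2. apply Rmult_lt_compat_r; assumption.
Qed.

Section Codes.
Context {X : Type} (d : X -> X -> R) (Hm : is_metric d) (pts : nat -> X)
  (Hpts : forall x eps, 0 < eps -> exists n, d x (pts n) < eps).

Lemma fine_cells F eps : c2R d F -> 0 < eps -> exists L,
  (forall s t, 0 <= s <= 1 -> 0 <= t <= 1 -> exists c, In c L /\ cell c s t) /\
  forall c, In c L -> forall s t s' t', 0 <= s <= 1 -> 0 <= t <= 1 -> cell c s t -> cell c s' t' ->
    d (F s' t') (F s t) < eps.
Proof.
  intros HF He.
  assert (D : forall u v, exists e : posreal, forall s t, Rabs (s - u) < 2 * e -> Rabs (t - v) < 2 * e ->
    d (F s t) (F u v) < eps / 2).
  { intros u v. destruct (HF u v (eps / 2)) as [e [P K]]; [lra|].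
    assert (P' : 0 < e / 2) by lra. exists (mkposreal _ P'). simpl. intros s t Hs Ht. apply K; lra. }
  assert (D' : forall u, exists delta : R -> posreal, forall v s t, Rabs (s - u) < 2 * delta v ->
    Rabs (t - v) < 2 * delta v -> d (F s t) (F u v) < eps / 2).
  { intros u. specialize (D u). apply functional_choice in D. exact D. }
  apply functional_choice in D'. destruct D' as [delta HD].
  destruct (compactness_value_2d 0 1 0 1 delta) as [e Leb].
  (* Two points of a cell differ in each coordinate by less than twice the mesh, hence by less than
     [e]; the doubled radius in [D] absorbs this. *)
  destruct (archimed_cor1 (e / 2)) as [m [Hmm Pm]]; [pose proof (cond_pos e); lra|].
  destruct m as [|m]; [lia|].
  exists (list_prod (list_prod (m :: nil) (seq 0 (S (S m)))) (seq 0 (S (S m)))). split.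
  - intros s t Hs Ht.
    destruct (grid_point m s Hs) as [i [Hi Ki]], (grid_point m t Ht) as [j [Hj Kj]].
    exists (m, i, j). split; [|split; assumption].
    apply in_prod; [apply in_prod; [left; reflexivity|]|]; apply in_seq; lia.
  - intros [[m' i] j] Hin s t s' t' Hs Ht [C1 C2] [C1' C2'].
    apply in_prod_iff in Hin. destruct Hin as [Hin _]. apply in_prod_iff in Hin.
    destruct Hin as [[<-|[]] _].
    specialize (Leb s t Hs Ht). apply NNPP in Leb. destruct Leb as [u [v [_ [_ [Hu [Hv Hd]]]]]].
    assert (A : d (F s t) (F u v) < eps / 2) by (apply (HD u v); pose proof (cond_pos (delta u v)); lra).
    assert (B : d (F s' t') (F u v) < eps / 2).
    { apply (HD u v); revert C1 C2 C1' C2' Hu Hv; unfold Rabs; repeat destruct (Rcase_abs _); lra. }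
    pose proof (dist_tri d Hm (F s' t') (F u v) (F s t)) as T.
    rewrite (dist_sym d Hm (F u v)) in T. lra.
Qed.

(** A code attaches to each cell of a finite cover a nearby point of the dense sequence. There are
    countably many codes, and maps with a common code are uniformly close on the square, so codes
    provide the sets [cov] of [analytic_rel]. *)
Definition codes (eps : R) (l : list (nat * nat * nat * nat)) (F : R -> R -> X) : Prop :=
  (forall s t, 0 <= s <= 1 -> 0 <= t <= 1 -> exists c k, In (c, k) l /\ cell c s t) /\
  forall c k, In (c, k) l -> forall s t, 0 <= s <= 1 -> 0 <= t <= 1 -> cell c s t ->
    d (F s t) (pts k) < eps.

Lemma code_exists F eps : c2R d F -> 0 < eps -> exists l, codes eps l F.
Proof.
  intros HF He. destruct (fine_cells F (eps / 2) HF) as [L [HL K]]; [lra|].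
  assert (D : forall c, exists k, In c L -> forall s t, 0 <= s <= 1 -> 0 <= t <= 1 -> cell c s t ->
    d (F s t) (pts k) < eps).
  { intros c. destruct (classic (In c L /\ exists s t, 0 <= s <= 1 /\ 0 <= t <= 1 /\ cell c s t))
      as [[Hc [s0 [t0 [Hs0 [Ht0 H0]]]]]|N].
    - destruct (Hpts (F s0 t0) (eps / 2)) as [k Hk]; [lra|]. exists k. intros _ s t Hs Ht H.
      pose proof (K c Hc s0 t0 s t Hs0 Ht0 H0 H).
      pose proof (dist_tri d Hm (F s t) (F s0 t0) (pts k)). lra.
    - exists 0%nat. intros Hc s t Hs Ht H. exfalso. apply N. eauto 8. }
  apply functional_choice in D. destruct D as [k Hk].
  exists (map (fun c => (c, k c)) L). split.
  - intros s t Hs Ht. destruct (HL s t Hs Ht) as [c [Hc H]]. exists c, (k c). split; [|exact H].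
    apply in_map_iff. eauto.
  - intros c k' Hin. apply in_map_iff in Hin. destruct Hin as [c' [E Hc]].
    injection E as -> <-. apply Hk, Hc.
Qed.

Lemma codes_close eps l F G : codes eps l F -> codes eps l G ->
  forall s t, 0 <= s <= 1 -> 0 <= t <= 1 -> d (F s t) (G s t) < 2 * eps.
Proof.
  intros [C KF] [_ KG] s t Hs Ht. destruct (C s t Hs Ht) as [c [k [Hin Hc]]].
  specialize (KF c k Hin s t Hs Ht Hc). specialize (KG c k Hin s t Hs Ht Hc).
  pose proof (dist_tri d Hm (F s t) (pts k) (G s t)) as T.
  rewrite (dist_sym d Hm (pts k)) in T. lra.
Qed.

Context (Hcomplete : complete d).

(** Eventually sharing a code at every precision makes the sequence uniformly Cauchy on the square.
    The limit is taken at clamped arguments, which extends it continuously to the plane. *)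
Lemma codes_limit (Fs : nat -> R -> R -> X) : (forall n, c2R d (Fs n)) ->
  (forall eps, 0 < eps -> exists l N, forall n, (N <= n)%nat -> codes eps l (Fs n)) ->
  exists F, c2R d F /\ forall eps, 0 < eps -> exists N, forall n, (N <= n)%nat ->
    forall s t, 0 <= s <= 1 -> 0 <= t <= 1 -> d (Fs n s t) (F s t) < eps.
Proof.
  intros HFs HC.
  assert (HC' : forall eps, 0 < eps -> exists N, forall n m, (N <= n)%nat -> (N <= m)%nat ->
    forall s t, 0 <= s <= 1 -> 0 <= t <= 1 -> d (Fs n s t) (Fs m s t) < eps).
  { intros eps He. destruct (HC (eps / 2)) as [l [N H]]; [lra|]. exists N.
    intros n m Hn Hm' s t Hs Ht. replace eps with (2 * (eps / 2)) by lra.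
    apply (codes_close _ l); auto. }
  assert (L : forall p : R * R, exists z, forall eps, 0 < eps -> exists N, forall n, (N <= n)%nat ->
    d (Fs n (clamp (fst p)) (clamp (snd p))) z < eps).
  { intros [s t]. apply (Hcomplete (fun n => Fs n (clamp s) (clamp t))).
    intros eps He. destruct (HC' eps He) as [N H]. exists N.
    intros m n Hm' Hn. apply H; auto using clamp_range. }
  apply functional_choice in L. destruct L as [F0 HF0].
  assert (U : forall eps, 0 < eps -> exists N, forall n, (N <= n)%nat ->
    forall s t, d (Fs n (clamp s) (clamp t)) (F0 (s, t)) < eps).
  { intros eps He. destruct (HC' (eps / 2)) as [N H]; [lra|]. exists N. intros n Hn s t.
    destruct (HF0 (s, t) (eps / 2)) as [M HM]; [lra|]. simpl in HM.
    pose proof (HM (Nat.max N M) ltac:(lia)).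
    pose proof (H n (Nat.max N M) Hn ltac:(lia) (clamp s) (clamp t) (clamp_range s) (clamp_range t)).
    pose proof (dist_tri d Hm (Fs n (clamp s) (clamp t)) (Fs (Nat.max N M) (clamp s) (clamp t)) (F0 (s, t))).
    lra. }
  exists (fun s t => F0 (s, t)). split.
  - intros s t eps He. destruct (U (eps / 3)) as [N HN]; [lra|].
    destruct (HFs N (clamp s) (clamp t) (eps / 3)) as [e [P K]]; [lra|].
    exists e. split; [exact P|]. intros s' t' Hs Ht.
    pose proof (clamp_lipschitz s' s). pose proof (clamp_lipschitz t' t).
    assert (Q : d (Fs N (clamp s') (clamp t')) (Fs N (clamp s) (clamp t)) < eps / 3) by (apply K; lra).
    pose proof (HN N (le_n N) s t). pose proof (HN N (le_n N) s' t') as Q'.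
    rewrite (dist_sym d Hm) in Q'.
    pose proof (dist_tri d Hm (F0 (s', t')) (Fs N (clamp s') (clamp t')) (F0 (s, t))).
    pose proof (dist_tri d Hm (Fs N (clamp s') (clamp t')) (Fs N (clamp s) (clamp t)) (F0 (s, t))).
    lra.
  - intros eps He. destruct (U eps He) as [N HN]. exists N. intros n Hn s t Hs Ht.
    specialize (HN n Hn s t). rewrite !clamp_id in HN by assumption. exact HN.
Qed.

Lemma limit_unique (u v : nat -> X) a b :
  (forall eps, 0 < eps -> exists N, forall n, (N <= n)%nat -> d (u n) a < eps) ->
  (forall eps, 0 < eps -> exists N, forall n, (N <= n)%nat -> d (v n) b < eps) ->
  (forall n, u n = v n) -> a = b.
Proof.
  intros Hu Hv E. apply (dist_zero d Hm). intros eps He.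
  destruct (Hu (eps / 2)) as [N HN]; [lra|]. destruct (Hv (eps / 2)) as [M HM]; [lra|].
  specialize (HN (Nat.max N M) ltac:(lia)). specialize (HM (Nat.max N M) ltac:(lia)).
  rewrite <- E in HM. rewrite (dist_sym d Hm) in HN.
  pose proof (dist_tri d Hm a (u (Nat.max N M)) b). lra.
Qed.

Lemma constant_limit (x : X) :
  forall eps, 0 < eps -> exists N, forall n, (N <= n)%nat -> d x x < eps.
Proof. intros eps He. exists 0%nat. intros _ _. rewrite (dist_refl d Hm). exact He. Qed.

Lemma uniform_limit_at {x y} (ps : nat -> pth d x y) p t : uniform_limit d ps p -> 0 <= t <= 1 ->
  forall eps, 0 < eps -> exists N, forall n, (N <= n)%nat -> d (pf d (ps n) t) (pf d p t) < eps.
Proof. intros H Ht eps He. destruct (H eps He) as [N HN]. exists N. auto. Qed.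

Lemma pow_half_small eps : 0 < eps -> exists n, (/ 2) ^ n < eps.
Proof.
  intros He. destruct (pow_lt_1_zero (/ 2)) with eps as [N HN]; auto.
  - rewrite Rabs_right; lra.
  - exists N. specialize (HN N (le_n N)). rewrite Rabs_right in HN; [exact HN|].
    apply Rle_ge, pow_le. lra.
Qed.

Lemma codes_mono eps eps' l F : eps <= eps' -> codes eps l F -> codes eps' l F.
Proof.
  intros L [C K]. split; [exact C|]. intros c k Hin s t Hs Ht Hc.
  specialize (K c k Hin s t Hs Ht Hc). lra.
Qed.

Lemma countable_code : countable (list (nat * nat * nat * nat)).
Proof. apply countable_list. repeat apply countable_prod; apply countable_nat. Qed.

(** The witnesses are homotopies, covered by codes. Their end conditions are required only for [t]
    in the unit interval, where uniform convergence controls the limit; clamping [t] in the limit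
    restores them for all [t]. *)
Lemma hpt_analytic : analytic_rel d (@hpt X d).
Proof.
  intros x. destruct countable_code as [dec Hdec].
  exists (R -> R -> X), (fun p q H => c2R d H /\ (forall s, 0 <= s <= 1 -> H s 0 = pf d p s) /\
    (forall s, 0 <= s <= 1 -> H s 1 = pf d q s) /\ forall t, 0 <= t <= 1 -> H 0 t = x /\ H 1 t = x),
    (fun n k H => codes ((/ 2) ^ n) (dec k) H).
  split; [|split].
  - intros p q [H [C [H0 [H1 He]]]]. exists H. auto.
  - intros p q H [C _] n. destruct (code_exists H ((/ 2) ^ n) C) as [l Hl]; [apply pow_lt; lra|].
    destruct (Hdec l) as [k <-]. eauto.
  - intros p q ps qs Hs k Hps Hqs HC Hcov.
    destruct (codes_limit Hs) as [H [CH LH]].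
    + intros n. apply HC.
    + intros eps He. destruct (pow_half_small eps He) as [m Hpow]. exists (dec (k m)), (S m).
      intros n Hn. apply codes_mono with ((/ 2) ^ m); [lra|]. apply Hcov. lia.
    + assert (LH' : forall s t, 0 <= s <= 1 -> 0 <= t <= 1 ->
        forall eps, 0 < eps -> exists N, forall n, (N <= n)%nat -> d (Hs n s t) (H s t) < eps).
      { intros s t S1 T1 eps He. destruct (LH eps He) as [N HN]. exists N. auto. }
      exists (fun s t => H s (clamp t)). split; [|split; [|split]].
      * apply (c2R_comp d H (fun s _ => s) (fun _ t => clamp t)); [exact CH|rc2|apply rc2_clamp; rc2].
      * intros s Hs1. rewrite clamp_id by lra.
        apply (limit_unique (fun n => Hs n s 0) (fun n => pf d (ps n) s)).
        -- apply LH'; lra.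
        -- apply uniform_limit_at; assumption.
        -- intros n. apply HC, Hs1.
      * intros s Hs1. rewrite clamp_id by lra.
        apply (limit_unique (fun n => Hs n s 1) (fun n => pf d (qs n) s)).
        -- apply LH'; lra.
        -- apply uniform_limit_at; assumption.
        -- intros n. apply HC, Hs1.
      * intros t. pose proof (clamp_range t) as Ht. split.
        -- apply (limit_unique (fun n => Hs n 0 (clamp t)) (fun _ => x)).
           ++ apply LH'; lra.
           ++ apply constant_limit.
           ++ intros n. apply HC, Ht.
        -- apply (limit_unique (fun n => Hs n 1 (clamp t)) (fun _ => x)).
           ++ apply LH'; lra.
           ++ apply constant_limit.
           ++ intros n. apply HC, Ht.
Qed.
End Codes.

(** * Boundaries of singular 2-chains *)

Lemma ind_true (P : Prop) : P -> ind P = 1%Z.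
Proof. intros H. unfold ind. destruct (excluded_middle_informative P); tauto. Qed.

Lemma ind_false (P : Prop) : ~ P -> ind P = 0%Z.
Proof. intros H. unfold ind. destruct (excluded_middle_informative P); tauto. Qed.

Lemma sumZ_app l l' : sumZ (l ++ l') = (sumZ l + sumZ l')%Z.
Proof. induction l as [|a l IH]; simpl; [reflexivity|]. rewrite IH. lia. Qed.

Lemma sumZ_map_plus {A} (f g : A -> Z) l :
  sumZ (map (fun a => (f a + g a)%Z) l) = (sumZ (map f l) + sumZ (map g l))%Z.
Proof. induction l as [|a l IH]; simpl; [reflexivity|]. rewrite IH. lia. Qed.

Lemma sumZ_map_scale {A} (k : Z) (f : A -> Z) l :
  sumZ (map (fun a => (k * f a)%Z) l) = (k * sumZ (map f l))%Z.
Proof. induction l as [|a l IH]; simpl; [lia|]. rewrite IH. lia. Qed.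

Lemma sumZ_map_zero {A} (f : A -> Z) l : (forall a, In a l -> f a = 0%Z) -> sumZ (map f l) = 0%Z.
Proof.
  induction l as [|a l IH]; simpl; intros H; [reflexivity|].
  rewrite H, IH; auto.
Qed.

Lemma sumZ_ind {A} (phi : A -> Z) (a : A) L : NoDup L -> In a L ->
  sumZ (map (fun b => (ind (a = b) * phi b)%Z) L) = phi a.
Proof.
  induction 1 as [|b L Hb _ IH]; intros Hin; [destruct Hin|].
  simpl. destruct Hin as [->|Hin].
  - rewrite ind_true by reflexivity. rewrite sumZ_map_zero; [lia|].
    intros b Hin. rewrite ind_false; [lia|]. intros ->. tauto.
  - rewrite IH by exact Hin. rewrite ind_false; [lia|]. intros ->. tauto.
Qed.

Definition dsum {Y} (tau : D2 -> Y) (s : I01 -> Y) : Z :=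
  (ind ((fun t => tau (face0_map t)) = s) - ind ((fun t => tau (face1_map t)) = s)
   + ind ((fun t => tau (face2_map t)) = s))%Z.

Definition sgn (e : bool) : Z := if e then 1%Z else (-1)%Z.

(** Signed lists with repetitions stand for 2-chains: sums become concatenations and negation flips
    signs, without merging supports. *)
Definition bsum {Y} (l : list (bool * (D2 -> Y))) (s : I01 -> Y) : Z :=
  sumZ (map (fun p => (sgn (fst p) * dsum (snd p) s)%Z) l).

Section Boundaries.
Context {X : Type} (d : X -> X -> R) (Hm : is_metric d).

Lemma boundary_of_list l : (forall p, In p l -> cont2 d (snd p)) -> is_boundary1 d (bsum l).
Proof.
  induction l as [|[e tau] l IH]; intros Hl.
  - exists (fun _ => 0%Z), nil. split; [split; [constructor|]; congruence|]. reflexivity.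
  - destruct IH as [b [L [[ND HL] Hb]]]; [intros p Hp; apply Hl; right; exact Hp|].
    (* The support list is enlarged to contain [tau]; a simplex outside [L] has coefficient 0, so
       the sums do not change. *)
    assert (Hin : exists L', NoDup L' /\ In tau L' /\ (forall a, In a L -> In a L') /\
      forall phi, sumZ (map (fun a => (b a * phi a)%Z) L') = sumZ (map (fun a => (b a * phi a)%Z) L)).
    { destruct (classic (In tau L)) as [Hi|Hi].
      - exists L. auto.
      - exists (tau :: L). split; [constructor; assumption|]. split; [left; reflexivity|].
        split; [intros; right; assumption|]. intros phi. simpl.
        assert (E : b tau = 0%Z) by (apply NNPP; intros N; apply Hi, HL, N). rewrite E. lia. }
    destruct Hin as [L' [ND' [Ht [Hinc Hsum]]]].
    exists (fun a => (b a + sgn e * ind (tau = a))%Z), L'. split.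
    + split; [exact ND'|]. intros a Ha. destruct (classic (tau = a)) as [<-|Hne].
      * split; [exact Ht|]. apply (Hl (e, tau)). left. reflexivity.
      * rewrite ind_false in Ha by exact Hne. destruct (HL a) as [H1 H2]; [lia|]. auto.
    + intros s. unfold bsum. simpl. fold (bsum l s). rewrite Hb.
      change (fun tau0 => (b tau0 * _)%Z) with (fun tau0 => (b tau0 * dsum tau0 s)%Z).
      rewrite <- (Hsum (fun a => dsum a s)).
      rewrite <- (sumZ_ind (fun a => dsum a s) tau L' ND' Ht), <- sumZ_map_scale, <- sumZ_map_plus.
      f_equal. apply map_ext. intros a. unfold dsum. lia.
Qed.

Lemma boundary_list c : is_boundary1 d c -> exists l,
  (forall p, In p l -> cont2 d (snd p)) /\ forall s, c s = bsum l s.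
Proof.
  intros [b [L [[_ HL] Hc]]].
  assert (HL' : forall tau, b tau <> 0%Z -> cont2 d tau) by (intros tau H; apply HL, H).
  exists (flat_map (fun tau => repeat (Z.leb 0 (b tau), tau) (Z.to_nat (Z.abs (b tau)))) L). split.
  - intros p Hp. apply in_flat_map in Hp. destruct Hp as [tau [_ Hp]].
    pose proof (repeat_spec _ _ _ Hp) as ->. simpl. apply HL'. intros E. rewrite E in Hp. destruct Hp.
  - intros s. rewrite Hc.
    change (fun tau => (b tau * _)%Z) with (fun tau => (b tau * dsum tau s)%Z).
    clear. unfold bsum. induction L as [|tau L IH]; [reflexivity|].
    simpl. rewrite map_app, sumZ_app, <- IH. f_equal.
    assert (E : forall n e, sumZ (map (fun p : bool * (D2 -> X) => (sgn (fst p) * dsum (snd p) s)%Z)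
      (repeat (e, tau) n)) = (Z.of_nat n * (sgn e * dsum tau s))%Z).
    { induction n as [|n IHn]; intros e; [reflexivity|]. simpl repeat. simpl map. simpl sumZ.
      rewrite IHn, Nat2Z.inj_succ. simpl fst. simpl snd. ring. }
    rewrite E. unfold sgn. destruct (Z.leb_spec 0 (b tau)); rewrite Z2Nat.id by lia;
      [rewrite Z.abs_eq by lia|rewrite Z.abs_neq by lia]; ring.
Qed.

Lemma boundary_ext c c' : (forall s, c s = c' s) -> is_boundary1 d c -> is_boundary1 d c'.
Proof. intros E [b [L [H Hc]]]. exists b, L. split; [exact H|]. intros s. rewrite <- E. apply Hc. Qed.

Lemma boundary_zero : is_boundary1 d (fun _ => 0%Z).
Proof. apply (boundary_of_list nil). intros p []. Qed.

Lemma boundary_plus c c' : is_boundary1 d c -> is_boundary1 d c' -> is_boundary1 d (fun s => (c s + c' s)%Z).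
Proof.
  intros [l [Hl Hc]]%boundary_list [l' [Hl' Hc']]%boundary_list.
  apply boundary_ext with (bsum (l ++ l')).
  - intros s. rewrite Hc, Hc'. unfold bsum. rewrite map_app, sumZ_app. reflexivity.
  - apply boundary_of_list. intros p [Hp|Hp]%in_app_or; auto.
Qed.

Lemma boundary_opp c : is_boundary1 d c -> is_boundary1 d (fun s => (- c s)%Z).
Proof.
  intros [l [Hl Hc]]%boundary_list.
  apply boundary_ext with (bsum (map (fun p => (negb (fst p), snd p)) l)).
  - intros s. rewrite Hc. unfold bsum. rewrite map_map. clear. induction l as [|[[] tau] l IH];
      unfold sumZ in *; cbn [map fold_right fst snd negb sgn] in *;
      [reflexivity|rewrite IH; ring..].
  - apply boundary_of_list. intros p Hp. apply in_map_iff in Hp. destruct Hp as [q [<- Hq]]. apply (Hl q), Hq.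
Qed.

Lemma boundary_minus c c' : is_boundary1 d c -> is_boundary1 d c' -> is_boundary1 d (fun s => (c s - c' s)%Z).
Proof.
  intros H H'%boundary_opp. apply boundary_ext with (fun s => (c s + - c' s)%Z); [intros; lia|].
  apply boundary_plus; assumption.
Qed.

Lemma boundary_scale k c : is_boundary1 d c -> is_boundary1 d (fun s => (k * c s)%Z).
Proof.
  intros H. induction k as [|k IH|k IH] using Z.peano_ind.
  - apply boundary_ext with (fun _ => 0%Z); [intros; lia|apply boundary_zero].
  - apply boundary_ext with (fun s => (k * c s + c s)%Z); [intros; lia|apply boundary_plus; assumption].
  - apply boundary_ext with (fun s => (k * c s - c s)%Z); [intros; lia|apply boundary_minus; assumption].
Qed.

Definition triangle (T : R -> R -> X) (p : D2) : X := T (fst (proj1_sig p)) (snd (proj1_sig p)).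

Lemma triangle_cont T : c2R d T -> cont2 d (triangle T).
Proof.
  intros HT p eps He.
  destruct (HT (fst (proj1_sig p)) (snd (proj1_sig p)) eps He) as [e [P K]]. exists e. split; [exact P|].
  intros q Hq. set (u := fst _ - _) in Hq. set (v := snd _ - _) in Hq.
  pose proof (Rabs_pos u). pose proof (Rabs_pos v). apply K; [fold u|fold v]; lra.
Qed.

Definition restr (g : R -> X) (t : I01) : X := g (proj1_sig t).

Lemma restr_ext f g : (forall t, 0 <= t <= 1 -> f t = g t) -> restr f = restr g.
Proof. intros H. extensionality t. apply H, (proj2_sig t). Qed.

Lemma restr_cont g : cR d g -> cont1 d (restr g).
Proof.
  intros H t eps He. destruct (H (proj1_sig t) eps He) as [e [P K]]. exists e. split; [exact P|].
  intros s. apply K.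
Qed.

Lemma boundary_triangle (f0 f1 f2 : R -> X) T : c2R d T ->
  (forall t, 0 <= t <= 1 -> T (1 - t) t = f0 t) -> (forall t, 0 <= t <= 1 -> T 0 t = f1 t) ->
  (forall t, 0 <= t <= 1 -> T t 0 = f2 t) ->
  is_boundary1 d (fun s => (ind (restr f0 = s) - ind (restr f1 = s) + ind (restr f2 = s))%Z).
Proof.
  intros HT H0 H1 H2. apply boundary_ext with (bsum ((true, triangle T) :: nil)).
  - intros s. unfold bsum, dsum. cbn [map fst snd sumZ fold_right sgn].
    rewrite <- (restr_ext _ _ H0), <- (restr_ext _ _ H1), <- (restr_ext _ _ H2).
    change (fun t => triangle T (face0_map t)) with (restr (fun t => T (1 - t) t)).
    change (fun t => triangle T (face1_map t)) with (restr (T 0)).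
    change (fun t => triangle T (face2_map t)) with (restr (fun t => T t 0)).
    lia.
  - apply boundary_of_list. intros p [<-|[]]. apply triangle_cont, HT.
Qed.

Definition simplex {x y} (p : pth d x y) (s : I01 -> X) : Z := ind (restr (pf d p) = s).

Lemma boundary_cst x : is_boundary1 d (simplex (cst d Hm x)).
Proof.
  eapply boundary_ext; [|apply (boundary_triangle (fun _ => x) (fun _ => x) (fun _ => x) (fun _ _ => x)); auto].
  - intros s. unfold simplex. simpl. lia.
  - apply (cR_c2R d), cR_const, Hm.
Qed.

Lemma boundary_cat {x y z} (p : pth d x y) (q : pth d y z) :
  is_boundary1 d (fun s => (simplex (cat d Hm p q) s - simplex p s - simplex q s)%Z).
Proof.
  (* The parameter [t + s / 2] is affine on the triangle with values 0, 1/2, 1 at the vertices [e0],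
     [e1], [e2], so the faces are the two halves and the whole of [cat p q]. *)
  eapply boundary_ext; [|apply boundary_opp, (boundary_triangle (pf d q) (pf d (cat d Hm p q)) (pf d p)
    (fun s t => pf d (cat d Hm p q) (t + s * (1 / 2))))].
  - intros s. unfold simplex. lia.
  - apply (c2R_comp1 d (pf d (cat d Hm p q)) (fun s t => t + s * (1 / 2))); [apply pth_cont|rc2].
  - intros t Ht. simpl. unfold cat_fun. destruct (Rle_dec _ _) as [L|L].
    + assert (t = 0) by lra. subst t. rewrite pth_0. transitivity (pf d p 1); [f_equal; lra|apply pth_1].
    + f_equal. lra.
  - intros t Ht. f_equal. lra.
  - intros t Ht. simpl. unfold cat_fun. destruct (Rle_dec _ _) as [L|L]; [f_equal; lra|lra].
Qed.

(** The square is cut along its diagonal into two triangles. The diagonal cancels in their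
    difference, and the sides [s = 0] and [s = 1] are constant simplices, themselves boundaries. *)
Lemma boundary_hpt {x y} (p q : pth d x y) : hpt d p q ->
  is_boundary1 d (fun s => (simplex p s - simplex q s)%Z).
Proof.
  intros [H [C [H0 [H1 He]]]].
  assert (T1 : is_boundary1 d (fun s => (ind (restr (fun _ => y) = s) - ind (restr (fun t => H t t) = s)
    + ind (restr (pf d p) = s))%Z)).
  { apply boundary_triangle with (fun s t => H (s + t) t).
    - apply (c2R_comp d H (fun s t => s + t) (fun _ t => t)); auto; rc2.
    - intros t _. replace (1 - t + t) with 1 by lra. apply He.
    - intros t _. f_equal. lra.
    - intros t Ht. rewrite Rplus_0_r. auto. }
  assert (T2 : is_boundary1 d (fun s => (ind (restr (pf d q) = s) - ind (restr (fun t => H t t) = s)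
    + ind (restr (fun _ => x) = s))%Z)).
  { apply boundary_triangle with (fun s t => H t (s + t)).
    - apply (c2R_comp d H (fun _ t => t) (fun s t => s + t)); auto; rc2.
    - intros t Ht. replace (1 - t + t) with 1 by lra. auto.
    - intros t _. f_equal. lra.
    - intros t _. apply He. }
  pose proof (boundary_minus _ _ (boundary_minus _ _ T1 T2)
    (boundary_minus _ _ (boundary_cst y) (boundary_cst x))) as B.
  eapply boundary_ext; [|exact B]. intros s. unfold simplex. simpl. lia.
Qed.

Definition hml (x y : X) (p q : pth d x y) : Prop := homologous d (simplex p) (simplex q).

#[export] Instance hml_congruence : path_congruence d Hm hml.
Proof.
  split.
  - intros x y p q H%boundary_opp. eapply boundary_ext; [|exact H]. intros s. cbv beta. lia.
  - intros x y p q r H K. eapply boundary_ext; [|exact (boundary_plus _ _ H K)]. intros s. cbv beta. lia.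
  - intros x y p q H. apply boundary_hpt, H.
  - intros x y z p p' q q' H K.
    eapply boundary_ext; [|exact (boundary_plus _ _ (boundary_minus _ _ (boundary_cat p q) (boundary_cat p' q'))
      (boundary_plus _ _ H K))].
    intros s. cbv beta. lia.
Qed.

Lemma boundary_reversal {x y} (p : pth d x y) :
  is_boundary1 d (fun s => (simplex p s + simplex (reversal d p) s)%Z).
Proof.
  pose proof (boundary_hpt _ _ (hpt_cat_reversal d Hm p)) as H.
  eapply boundary_ext; [|exact (boundary_minus _ _ (boundary_plus _ _ H (boundary_cst x))
    (boundary_cat p (reversal d p)))].
  intros s. cbv beta. lia.
Qed.

End Boundaries.

(** * The homology relation is analytic *)

Definition occurrences {Y} (l : list Y) (y : Y) : Z := sumZ (map (fun z => ind (z = y)) l).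

Lemma occurrences_app {Y} (l l' : list Y) y :
  occurrences (l ++ l') y = (occurrences l y + occurrences l' y)%Z.
Proof. unfold occurrences. rewrite map_app, sumZ_app. reflexivity. Qed.

Lemma occurrences_cons {Y} (z : Y) l y : occurrences (z :: l) y = (ind (z = y) + occurrences l y)%Z.
Proof. reflexivity. Qed.

Lemma occurrences_permutation {Y} (l l' : list Y) : Permutation l l' ->
  forall y, occurrences l y = occurrences l' y.
Proof. intros H y. unfold occurrences. induction H; simpl in *; lia. Qed.

Lemma permutation_of_occurrences {Y} (l l' : list Y) :
  (forall y, occurrences l y = occurrences l' y) -> Permutation l l'.
Proof.
  intros H.
  assert (dec : forall a b : Y, {a = b} + {a <> b}) by (intros; apply excluded_middle_informative).
  assert (E : forall k y, occurrences k y = Z.of_nat (count_occ dec k y)).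
  { intros k y. unfold occurrences. induction k as [|z k IH]; [reflexivity|].
    simpl. rewrite IH. destruct (dec z y) as [e|ne]; [rewrite ind_true by exact e|rewrite ind_false by exact ne]; lia. }
  apply (Permutation_count_occ dec). intros y. specialize (H y). rewrite !E in H. lia.
Qed.

(** [P] stands for convergence. With the positions in the lists fixed, equality is a family of
    pointwise equations, each of which passes to the limit; this is why multisets are ordered by a
    permutation beforehand. *)
Lemma map_eq_limit {A B Y} (P : (nat -> Y) -> Y -> Prop) (f g : nat -> A -> B -> Y) (f' g' : A -> B -> Y)
  (l l' : list A) :
  (forall (u v : nat -> Y) a b, P u a -> P v b -> (forall n, u n = v n) -> a = b) ->
  (forall n, map (f n) l = map (g n) l') ->
  (forall a b, P (fun n => f n a b) (f' a b)) -> (forall a b, P (fun n => g n a b) (g' a b)) ->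
  map f' l = map g' l'.
Proof.
  intros HP E Hf Hg. revert l' E. induction l as [|a l IH]; intros [|a' l'] E.
  - reflexivity.
  - discriminate (E 0%nat).
  - discriminate (E 0%nat).
  - simpl. f_equal.
    + extensionality b. apply (HP (fun n => f n a b) (fun n => g n a' b)); auto.
      intros n. pose proof (E n) as En. simpl in En. congruence.
    + apply IH. intros n. pose proof (E n) as En. simpl in En. congruence.
Qed.

Lemma retract_pf (a b : R) :
  0 <= fst (clamp a, Rmin (clamp b) (1 - clamp a)) /\ 0 <= snd (clamp a, Rmin (clamp b) (1 - clamp a)) /\
  fst (clamp a, Rmin (clamp b) (1 - clamp a)) + snd (clamp a, Rmin (clamp b) (1 - clamp a)) <= 1.
Proof.
  simpl. pose proof (clamp_range a). pose proof (clamp_range b).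
  unfold Rmin. destruct (Rle_dec _ _); lra.
Qed.

(** A retraction of the plane onto the triangle, by which singular 2-simplices extend to the plane
    and the codes on the square apply to them. *)
Definition retract (a b : R) : D2 := exist _ (clamp a, Rmin (clamp b) (1 - clamp a)) (retract_pf a b).

Lemma retract_id (p : D2) : retract (fst (proj1_sig p)) (snd (proj1_sig p)) = p.
Proof.
  apply eq_sig_hprop; [intros; apply proof_irrelevance|].
  destruct p as [[a b] [Ha [Hb Hab]]]. simpl in *.
  rewrite !clamp_id by lra. rewrite Rmin_left by lra. reflexivity.
Qed.

Section HomologyAnalytic.
Context {X : Type} (d : X -> X -> R) (Hm : is_metric d).

Lemma retract_cont tau : cont2 d tau -> c2R d (fun a b => tau (retract a b)).
Proof.
  intros H a b eps He. destruct (H (retract a b) eps He) as [e [P K]]. simpl in K.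
  assert (P' : 0 < e / 2) by lra.
  assert (C1 : rc2 (fun s t => clamp s)) by (apply rc2_clamp; rc2).
  assert (C2 : rc2 (fun s t => Rmin (clamp t) (1 - clamp s))).
  { apply rc2_min; [apply rc2_clamp|apply rc2_minus; [|apply rc2_clamp]]; rc2. }
  destruct (C1 a b (mkposreal _ P')) as [d1 D1], (C2 a b (mkposreal _ P')) as [d2 D2]. simpl in D1, D2.
  exists (Rmin d1 d2). split; [apply Rmin_pos; apply cond_pos|].
  intros s t Hs Ht. pose proof (Rmin_l d1 d2). pose proof (Rmin_r d1 d2).
  apply K. simpl. specialize (D1 s t ltac:(lra) ltac:(lra)). specialize (D2 s t ltac:(lra) ltac:(lra)).
  lra.
Qed.

Definition face (i : nat) (T : R -> R -> X) (t : I01) : X :=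
  match i with
  | 0%nat => triangle T (face0_map t)
  | 1%nat => triangle T (face1_map t)
  | _ => triangle T (face2_map t)
  end.

(* The label [(0, _)] stands for a given path, the label [(S j, i)] for the [i]-th face of the [j]-th triangle. *)
Definition labelled (g : R -> X) (T : nat -> R -> R -> X) (a : nat * nat) : I01 -> X :=
  match a with
  | (O, _) => restr g
  | (S j, i) => face i (T j)
  end.

(** In a boundary the faces 0 and 2 have sign plus and face 1 has sign minus; a negative coefficient
    exchanges the two lists. *)
Definition faces_of_sign (e : bool) (j : nat) : list (nat * nat) :=
  if e then (S j, 0%nat) :: (S j, 2%nat) :: nil else (S j, 1%nat) :: nil.

Definition positive_faces (sg : list bool) : list (nat * nat) :=
  flat_map (fun j => faces_of_sign (nth j sg true) j) (seq 0 (length sg)).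

Definition negative_faces (sg : list bool) : list (nat * nat) :=
  flat_map (fun j => faces_of_sign (negb (nth j sg true)) j) (seq 0 (length sg)).

Lemma labelled_faces g h T e js :
  map (labelled g T) (flat_map (fun j => faces_of_sign (e j) j) js) =
  map (labelled h T) (flat_map (fun j => faces_of_sign (e j) j) js).
Proof.
  apply map_ext_in. intros [[|j] i] H; [exfalso|reflexivity].
  apply in_flat_map in H. destruct H as [j [_ H]]. unfold faces_of_sign in H.
  destruct (e j); simpl in H; intuition discriminate.
Qed.

Lemma bsum_faces g T sg s :
  bsum (map (fun j => (nth j sg true, triangle (T j))) (seq 0 (length sg))) s =
  (occurrences (map (labelled g T) (positive_faces sg)) s -
   occurrences (map (labelled g T) (negative_faces sg)) s)%Z.
Proof.
  unfold positive_faces, negative_faces. generalize (seq 0 (length sg)). intros js.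
  induction js as [|j js IH]; [reflexivity|].
  cbn [flat_map map]. rewrite !map_app, !occurrences_app.
  unfold bsum in *. cbn [map sumZ fold_right]. fold (sumZ). fold sumZ in IH. unfold sumZ in *. rewrite IH.
  unfold faces_of_sign, occurrences, sumZ. cbn [fst snd].
  change (dsum (triangle (T j)) s) with
    (ind (face 0 (T j) = s) - ind (face 1 (T j) = s) + ind (face 2 (T j) = s))%Z.
  destruct (nth j sg true); cbn [sgn negb map labelled fold_right]; ring.
Qed.

(** The equation [p - q = positive - negative] is rewritten without signs: [p] with the negative
    faces and [q] with the positive faces form the same multiset. The ordering [pi] of the labels
    makes the matching explicit and leaves only equations between simplices. *)
Definition homology_pattern (g h : R -> X) (w : list bool * list (nat * nat) * (nat -> R -> R -> X)) : Prop :=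
  let '(sg, pi, T) := w in
  (forall j, c2R d (T j)) /\ Permutation pi ((0, 0)%nat :: positive_faces sg) /\
  map (labelled g T) ((0, 0)%nat :: negative_faces sg) = map (labelled h T) pi.

Lemma hml_of_pattern {x y} (p q : pth d x y) w : homology_pattern (pf d p) (pf d q) w -> hml d x y p q.
Proof.
  destruct w as [[sg pi] T]. intros [HT [Hpi E]].
  apply boundary_ext with (bsum (map (fun j => (nth j sg true, triangle (T j))) (seq 0 (length sg)))).
  - intros s. rewrite (bsum_faces (pf d p)).
    pose proof (occurrences_permutation _ _ (Permutation_map (labelled (pf d q) T) Hpi) s) as K.
    rewrite <- E in K. cbn [map] in K. rewrite !occurrences_cons in K. cbn [labelled] in K. unfold simplex.
    unfold positive_faces in *. rewrite (labelled_faces (pf d q) (pf d p)) in K. lia.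
  - apply boundary_of_list. intros r Hr. apply in_map_iff in Hr. destruct Hr as [j [<- _]].
    apply triangle_cont, HT.
Qed.

Lemma pattern_of_hml {x y} (p q : pth d x y) : hml d x y p q ->
  exists w, homology_pattern (pf d p) (pf d q) w.
Proof.
  intros H. destruct (boundary_list d _ H) as [l [Hl Hs]].
  (* Past the end of the list the triangle is a constant default, so that every [T j] is
     continuous. *)
  set (T := fun j => match nth_error l j with
    | Some r => fun a b => snd r (retract a b)
    | None => fun _ _ => x
    end).
  set (sg := map fst l).
  assert (HT : forall j, c2R d (T j)).
  { intros j. unfold T. destruct (nth_error l j) as [r|] eqn:E.
    - apply retract_cont, Hl. eapply nth_error_In, E.
    - apply (cR_c2R d), cR_const, Hm. }
  assert (El : l = map (fun j => (nth j sg true, triangle (T j))) (seq 0 (length sg))).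
  { apply nth_error_ext. intros j. rewrite nth_error_map.
    unfold sg. rewrite length_map.
    destruct (Nat.lt_ge_cases j (length l)) as [L|L].
    - rewrite nth_error_seq. assert (Lb : (j <? length l) = true) by (apply Nat.ltb_lt, L). rewrite Lb. simpl.
      unfold T. destruct (nth_error l j) as [[e tau]|] eqn:E.
      + f_equal. f_equal.
        * symmetry. apply nth_error_nth. rewrite nth_error_map, E. reflexivity.
        * extensionality r. unfold triangle. simpl. rewrite retract_id. reflexivity.
      + apply nth_error_None in E. lia.
    - rewrite (proj2 (nth_error_None l j) L).
      rewrite (proj2 (nth_error_None (seq 0 (length l)) j)); [reflexivity|]. rewrite length_seq. exact L. }
  assert (PM : Permutation (map (labelled (pf d p) T) ((0, 0)%nat :: negative_faces sg))
    (map (labelled (pf d q) T) ((0, 0)%nat :: positive_faces sg))).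
  { apply permutation_of_occurrences. intros s. specialize (Hs s). rewrite El in Hs.
    rewrite (bsum_faces (pf d p)) in Hs. unfold simplex in Hs.
    cbn [map]. rewrite !occurrences_cons. cbn [labelled].
    unfold positive_faces in *. rewrite (labelled_faces (pf d q) (pf d p)). lia. }
  (* The permutation of simplices lifts to one of labels, which becomes [pi]. *)
  apply Permutation_map_inv in PM. destruct PM as [pi [E Hpi]].
  exists (sg, pi, T). split; [exact HT|]. split; [symmetry; exact Hpi|exact E].
Qed.
Context (pts : nat -> X) (Hpts : forall x eps, 0 < eps -> exists n, d x (pts n) < eps)
  (Hcomplete : complete d).

Lemma labelled_limit (gs : nat -> R -> X) g Ts T :
  (forall t, 0 <= t <= 1 -> forall eps, 0 < eps -> exists N, forall n, (N <= n)%nat -> d (gs n t) (g t) < eps) ->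
  (forall j eps, 0 < eps -> exists N, forall n, (N <= n)%nat ->
    forall s t, 0 <= s <= 1 -> 0 <= t <= 1 -> d (Ts n j s t) (T j s t) < eps) ->
  forall a b eps, 0 < eps -> exists N, forall n, (N <= n)%nat ->
    d (labelled (gs n) (Ts n) a b) (labelled g T a b) < eps.
Proof.
  intros Hg HT [[|j] i] [t Ht] eps He.
  - apply (Hg t Ht eps He).
  - destruct (HT j eps He) as [N HN]. exists N. intros n Hn.
    destruct i as [|[|i]]; apply HN; simpl; auto; lra.
Qed.

Lemma hml_analytic : analytic_rel d (hml d).
Proof.
  intros x.
  assert (HcP : countable (list bool * list (nat * nat))).
  { apply countable_prod; apply countable_list; [apply countable_bool|].
    apply countable_prod; apply countable_nat. }
  destruct HcP as [decP HdecP], (countable_list _ countable_code) as [decC HdecC].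
  (* Level 0 fixes the discrete data. As [T] is an infinite sequence and a code is finite, level
     [S m] codes the first [m] members with precision [(/ 2) ^ m]; every member is reached
     eventually. *)
  exists (list bool * list (nat * nat) * (nat -> R -> R -> X))%type,
    (fun p q => homology_pattern (pf d p) (pf d q)),
    (fun n k w => match n with
      | O => decP k = fst w
      | S m => forall j, (j < m)%nat -> codes d pts ((/ 2) ^ m) (nth j (decC k) nil) (snd w j)
      end).
  split; [|split].
  - intros p q. apply pattern_of_hml.
  - intros p q [[sg pi] T] [HT _] [|m]; [apply HdecP|].
    assert (E : forall j, exists l, codes d pts ((/ 2) ^ m) l (T j)).
    { intros j. apply (code_exists d Hm pts Hpts); [apply HT|apply pow_lt; lra]. }
    apply functional_choice in E. destruct E as [l Hl].
    destruct (HdecC (map l (seq 0 m))) as [k Hk]. exists k. intros j Hj. rewrite Hk. simpl.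
    rewrite (nth_indep _ nil (l 0%nat)) by (rewrite length_map, length_seq; exact Hj).
    rewrite map_nth, seq_nth by exact Hj. apply Hl.
  - intros p q ps qs ws k Hps Hqs HC Hcov.
    destruct (decP (k 0%nat)) as [sg pi] eqn:Epat.
    (* The sequences are shifted by one because the cover at level 0 constrains the witnesses of
       positive index. *)
    assert (HC' : forall n, homology_pattern (pf d (ps (S n))) (pf d (qs (S n))) (sg, pi, snd (ws (S n)))).
    { intros n. specialize (HC (S n)). pose proof (Hcov (S n) 0%nat ltac:(lia)) as E.
      rewrite Epat in E. destruct (ws (S n)) as [w T]. simpl in E. subst w. exact HC. }
    assert (L : forall j, exists F, c2R d F /\ forall eps, 0 < eps -> exists N, forall n, (N <= n)%nat ->
      forall s t, 0 <= s <= 1 -> 0 <= t <= 1 -> d (snd (ws (S n)) j s t) (F s t) < eps).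
    { intros j. apply (codes_limit d Hm pts Hcomplete (fun n => snd (ws (S n)) j)).
      - intros n. apply (HC' n).
      - intros eps He. destruct (pow_half_small eps He) as [m Hpow].
        (* The maximum ensures both the precision [(/ 2) ^ m] and that member [j] is among the coded
           ones. *)
        exists (nth j (decC (k (S (Nat.max m (S j))))) nil), (S (Nat.max m (S j))). intros n Hn.
        apply codes_mono with ((/ 2) ^ (Nat.max m (S j))).
        + apply Rle_trans with ((/ 2) ^ m); [|lra].
          replace (Nat.max m (S j)) with (m + (Nat.max m (S j) - m))%nat by lia.
          rewrite pow_add. rewrite <- (Rmult_1_r ((/ 2) ^ m)) at 2.
          apply Rmult_le_compat_l; [apply pow_le; lra|].
          rewrite <- (pow1 (Nat.max m (S j) - m)). apply pow_incr. lra.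
        + apply (Hcov (S n) (S (Nat.max m (S j)))); lia. }
    apply functional_choice in L. destruct L as [T HT].
    apply hml_of_pattern with (sg, pi, T). split; [intros j; apply HT|].
    split; [apply (HC' 0%nat)|].
    apply (map_eq_limit (fun u a => forall eps, 0 < eps -> exists N, forall n, (N <= n)%nat -> d (u n) a < eps)
      (fun n => labelled (pf d (ps (S n))) (snd (ws (S n)))) (fun n => labelled (pf d (qs (S n))) (snd (ws (S n))))).
    + apply (limit_unique d Hm).
    + intros n. apply (HC' n).
    + apply (labelled_limit (fun n => pf d (ps (S n))) (pf d p) (fun n => snd (ws (S n)))); [|apply HT].
      intros t Ht eps He. destruct (Hps eps He) as [N HN]. exists N. intros n Hn. apply HN; auto with arith.
    + apply (labelled_limit (fun n => pf d (qs (S n))) (pf d q) (fun n => snd (ws (S n)))); [|apply HT].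
      intros t Ht eps He. destruct (Hqs eps He) as [N HN]. exists N. intros n Hn. apply HN; auto with arith.
Qed.
End HomologyAnalytic.

(** * Cycles and loops *)

Section Quotients.
Context {X : Type} (d : X -> X -> R) (Hm : is_metric d).

Lemma homologous_refl c : homologous d c c.
Proof. eapply boundary_ext; [|apply boundary_zero]. intros s. cbv beta. lia. Qed.

Lemma homologous_sym c c' : homologous d c c' -> homologous d c' c.
Proof. intros H%boundary_opp. eapply boundary_ext; [|exact H]. intros s. cbv beta. lia. Qed.

Lemma homologous_trans c c' c'' : homologous d c c' -> homologous d c' c'' -> homologous d c c''.
Proof.
  intros H K. eapply boundary_ext; [|exact (boundary_plus d _ _ H K)]. intros s. cbv beta. lia.
Qed.

Lemma simplex_cycle {x} (p : pth d x x) : is_cycle d (simplex d p).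
Proof.
  exists (restr (pf d p) :: nil). split.
  - split; [repeat constructor; intros []|]. intros s Hs. unfold simplex in Hs.
    destruct (classic (restr (pf d p) = s)) as [<-|N]; [|rewrite ind_false in Hs; tauto].
    split; [left; reflexivity|]. apply restr_cont, pth_cont.
  - intros y. simpl.
    change (restr (pf d p) i1) with (pf d p 1). change (restr (pf d p) i0) with (pf d p 0).
    rewrite pth_0, pth_1. lia.
Qed.

(** * Representing cycles by loops at the base point *)

Section Hurewicz.
Context (x0 : X) (Hpc : forall y : X, exists p : pth d x0 y, True).

Definition represented (c : (I01 -> X) -> Z) : Prop := exists g : pth d x0 x0, homologous d c (simplex d g).

Lemma represented_zero : represented (fun _ => 0%Z).
Proof.
  exists (cst d Hm x0). eapply boundary_ext; [|apply boundary_opp, (boundary_cst d Hm x0)].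
  intros s. cbv beta. lia.
Qed.

Lemma represented_plus c c' : represented c -> represented c' -> represented (fun s => (c s + c' s)%Z).
Proof.
  intros [g Hg] [h Hh]. exists (cat d Hm g h).
  eapply boundary_ext; [|exact (boundary_minus d _ _ (boundary_plus d _ _ Hg Hh) (boundary_cat d Hm g h))].
  intros s. cbv beta. lia.
Qed.

Lemma represented_opp c : represented c -> represented (fun s => (- c s)%Z).
Proof.
  intros [g Hg]. exists (reversal d g).
  eapply boundary_ext; [|apply boundary_opp, (boundary_plus d _ _ Hg (boundary_reversal d Hm g))].
  intros s. cbv beta. lia.
Qed.

Lemma represented_ext c c' : (forall s, c s = c' s) -> represented c -> represented c'.
Proof.
  intros E [g Hg]. exists g. eapply boundary_ext; [|exact Hg]. intros s. cbv beta. rewrite E. reflexivity.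
Qed.

Lemma represented_scale k c : represented c -> represented (fun s => (k * c s)%Z).
Proof.
  intros H. induction k as [|k IH|k IH] using Z.peano_ind.
  - apply represented_ext with (fun _ => 0%Z); [intros; lia|apply represented_zero].
  - apply represented_ext with (fun s => (k * c s + c s)%Z); [intros; lia|apply represented_plus; assumption].
  - apply represented_ext with (fun s => (k * c s + - c s)%Z); [intros; lia|].
    apply represented_plus; [assumption|apply represented_opp; assumption].
Qed.

Lemma represented_sum {A} (k : A -> Z) (l : A -> pth d x0 x0) (L : list A) :
  represented (fun s => sumZ (map (fun a => (k a * simplex d (l a) s)%Z) L)).
Proof.
  induction L as [|a L IH]; [apply represented_zero|].
  apply (represented_plus (fun s => (k a * simplex d (l a) s)%Z)); [|exact IH].
  apply represented_scale. exists (l a). apply homologous_refl.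
Qed.

Lemma boundary_sum {A} (k : A -> Z) (c : A -> (I01 -> X) -> Z) (L : list A) :
  (forall a, k a <> 0%Z -> is_boundary1 d (c a)) ->
  is_boundary1 d (fun s => sumZ (map (fun a => (k a * c a s)%Z) L)).
Proof.
  intros H. induction L as [|a L IH]; [apply boundary_zero|].
  apply (boundary_plus d (fun s => (k a * c a s)%Z)); [|exact IH].
  destruct (Z.eq_dec (k a) 0) as [->|N]; [|apply boundary_scale; auto].
  apply boundary_ext with (fun _ => 0%Z); [reflexivity|apply boundary_zero].
Qed.

(* Joining the endpoints of each simplex of a cycle to [x0] does not change the cycle,
   because the joining paths cancel. *)
Lemma cycle_represented c : is_cycle d c -> represented c.
Proof.
  intros [L [[ND HL] Hcyc]].
  assert (J : exists p : forall y, pth d x0 y, True).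
  { exists (fun y => proj1_sig (constructive_indefinite_description _ (Hpc y))). exact I. }
  destruct J as [p _].
  set (delta := fun (s s' : I01 -> X) => ind (s = s')).
  assert (HD : forall s : I01 -> X, exists l : pth d x0 x0, cont1 d s -> is_boundary1 d (fun s' =>
    (delta s s' - simplex d l s' - (simplex d (p (s i1)) s' - simplex d (p (s i0)) s'))%Z)).
  { intros s. destruct (classic (cont1 d s)) as [Hs|N]; [|exists (cst d Hm x0); tauto].
    set (q := pth_of_I01 d s Hs eq_refl eq_refl).
    exists (cat d Hm (cat d Hm (p (s i0)) q) (reversal d (p (s i1)))). intros _.
    assert (E : restr (pf d q) = s).
    { extensionality t. unfold restr. simpl. rewrite clampI_proj. reflexivity. }
    pose proof (boundary_plus d _ _ (boundary_cat d Hm (cat d Hm (p (s i0)) q) (reversal d (p (s i1))))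
      (boundary_plus d _ _ (boundary_cat d Hm (p (s i0)) q) (boundary_reversal d Hm (p (s i1))))) as B.
    apply boundary_opp in B.
    eapply boundary_ext; [|exact B]. intros s'. cbv beta.
    assert (Es : simplex d q s' = delta s s') by (unfold simplex, delta; rewrite E; reflexivity).
    lia. }
  apply functional_choice in HD. destruct HD as [l Hl].
  destruct (represented_sum c l L) as [g Hg]. exists g.
  assert (B := boundary_sum c (fun s s' => (delta s s' - simplex d (l s) s' -
    (simplex d (p (s i1)) s' - simplex d (p (s i0)) s'))%Z) L (fun s Hs => Hl s (proj2 (HL s Hs)))).
  eapply boundary_ext; [|exact (boundary_plus d _ _ Hg B)]. intros s'. cbv beta.
  assert (E1 : sumZ (map (fun s => (c s * delta s s')%Z) L) = c s').
  { destruct (classic (In s' L)) as [Hin|N].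
    - rewrite <- (sumZ_ind c s' L ND Hin). f_equal. apply map_ext. intros s. unfold delta.
      destruct (classic (s = s')) as [->|Hne]; [lia|].
      rewrite !ind_false by congruence. lia.
    - assert (Ec : c s' = 0%Z) by (apply NNPP; intros K; apply N, HL, K).
      rewrite Ec. apply sumZ_map_zero. intros s Hin. unfold delta. rewrite ind_false; [lia|].
      intros ->. tauto. }
  assert (E2 : sumZ (map (fun s => (c s * (simplex d (p (s i1)) s' - simplex d (p (s i0)) s'))%Z) L) = 0%Z).
  (* A joining path is determined by its end point, so the joining terms at [s'] see only the point
     [s' i1] and sum to a multiple of the cycle condition there. *)
  { assert (Q : forall y, simplex d (p y) s' = (simplex d (p (s' i1)) s' * ind (y = s' i1))%Z).
    { intros y. destruct (classic (y = s' i1)) as [->|N].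
      - rewrite (ind_true (s' i1 = s' i1)) by reflexivity. lia.
      - rewrite (ind_false _ N). unfold simplex at 1. rewrite ind_false; [lia|].
        intros K. apply N. rewrite <- K. symmetry. apply pth_1. }
    transitivity (simplex d (p (s' i1)) s' *
      sumZ (map (fun s => (c s * (ind (s i1 = s' i1) - ind (s i0 = s' i1)))%Z) L))%Z.
    - rewrite <- sumZ_map_scale. f_equal. apply map_ext. intros s.
      rewrite (Q (s i1)), (Q (s i0)). ring.
    - rewrite Hcyc. lia. }
  assert (E3 : sumZ (map (fun s => (c s * (delta s s' - simplex d (l s) s' -
      (simplex d (p (s i1)) s' - simplex d (p (s i0)) s')))%Z) L) =
    (sumZ (map (fun s => (c s * delta s s')%Z) L) - sumZ (map (fun s => (c s * simplex d (l s) s')%Z) L)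
     - sumZ (map (fun s => (c s * (simplex d (p (s i1)) s' - simplex d (p (s i0)) s'))%Z) L))%Z).
  { clear. induction L as [|s L IH]; [reflexivity|]. cbn [map sumZ fold_right]. unfold sumZ in IH. rewrite IH. ring. }
  rewrite E3, E1, E2. lia.
Qed.
End Hurewicz.

(** * Codes of loops and the two dichotomies *)

Section LoopCodes.
Context (pts : nat -> X) (Hpts : forall x eps, 0 < eps -> exists n, d x (pts n) < eps).

(** The code records which balls around the dense sequence contain the value at each nonnegative
    rational time; by continuity it determines the path on the unit interval. *)
Definition path_code (g : R -> X) (n : nat) : bool :=
  let (q, r) := Cantor.of_nat n in let (i, m) := Cantor.of_nat q in let (j, k) := Cantor.of_nat r in
  decide (d (g (INR i / INR (S m))) (pts j) < / INR (S k)).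

Lemma path_code_inj g h : cR d g -> cR d h -> path_code g = path_code h ->
  forall t, 0 <= t <= 1 -> g t = h t.
Proof.
  intros Hg Hh E t Ht. apply (dist_zero d Hm). intros eps He.
  destruct (Hg t (eps / 4)) as [e1 [P1 K1]]; [lra|]. destruct (Hh t (eps / 4)) as [e2 [P2 K2]]; [lra|].
  destruct (archimed_cor1 (Rmin e1 e2)) as [m [Hmm Pm]]; [apply Rmin_pos; assumption|].
  destruct m as [|m]; [lia|].
  destruct (grid_point m t Ht) as [i [_ Hi]].
  destruct (archimed_cor1 (eps / 4)) as [k [Hk Pk]]; [lra|]. destruct k as [|k]; [lia|].
  set (q := INR i / INR (S m)) in *.
  destruct (Hpts (g q) (/ INR (S k))) as [j Hj]; [apply Rinv_0_lt_compat, lt_0_INR; lia|].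
  apply (f_equal (fun f => f (Cantor.to_nat (Cantor.to_nat (i, m), Cantor.to_nat (j, k))))) in E.
  unfold path_code in E. rewrite !Cantor.cancel_of_to in E. apply decide_ext in E. fold q in E.
  pose proof (proj1 E Hj) as Hj'.
  pose proof (Rmin_l e1 e2). pose proof (Rmin_r e1 e2). rewrite Rabs_minus_sym in Hi.
  specialize (K1 q ltac:(lra)). specialize (K2 q ltac:(lra)).
  pose proof (dist_tri d Hm (g t) (g q) (h t)) as T1.
  pose proof (dist_tri d Hm (g q) (pts j) (h t)) as T2.
  pose proof (dist_tri d Hm (pts j) (h q) (h t)) as T3.
  rewrite (dist_sym d Hm (g t) (g q)) in T1. rewrite (dist_sym d Hm (pts j) (h q)) in T3. lra.
Qed.
End LoopCodes.

Lemma loop_restr {x} (p : pth d x x) : is_loop d x (restr (pf d p)).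
Proof.
  split; [apply restr_cont, pth_cont|]. split; [apply (pth_0 d _ _ p)|apply (pth_1 d _ _ p)].
Qed.

Lemma restr_of_loop x g : is_loop d x g -> exists p : pth d x x, g = restr (pf d p).
Proof.
  intros [Hg [H0 H1]]. exists (pth_of_I01 d g Hg H0 H1).
  extensionality t. unfold restr. simpl. rewrite clampI_proj. reflexivity.
Qed.

Lemma loop_homotopic_restr {x} (p q : pth d x x) :
  loop_homotopic d x (restr (pf d p)) (restr (pf d q)) <-> hpt d p q.
Proof.
  split.
  - intros [H [C [H0 [H1 He]]]]. exists (fun s t => H (clampI s) (clampI t)). split; [|split; [|split]].
    + intros s t eps Heps. destruct (C (clampI s) (clampI t) eps Heps) as [e [P K]].
      exists (e / 2). split; [lra|]. intros s' t' Hs Ht. apply K. simpl.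
      pose proof (clamp_lipschitz s' s). pose proof (clamp_lipschitz t' t). lra.
    + intros s Hs. rewrite clampI_0, H0. unfold restr. simpl. rewrite clamp_id by exact Hs. reflexivity.
    + intros s Hs. rewrite clampI_1, H1. unfold restr. simpl. rewrite clamp_id by exact Hs. reflexivity.
    + intros t. rewrite clampI_0, clampI_1. apply He.
  - intros [H [C [H0 [H1 He]]]]. exists (fun s t => H (proj1_sig s) (proj1_sig t)). split; [|split; [|split]].
    + intros s t eps Heps. destruct (C (proj1_sig s) (proj1_sig t) eps Heps) as [e [P K]].
      exists e. split; [exact P|]. intros s' t' Hst.
      pose proof (Rabs_pos (proj1_sig s' - proj1_sig s)). pose proof (Rabs_pos (proj1_sig t' - proj1_sig t)).
      apply K; lra.
    + intros s. apply H0, (proj2_sig s).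
    + intros s. apply H1, (proj2_sig s).
    + intros t. apply He.
Qed.

Context (Hcomplete : complete d) (Hsep : separable d) (Hconn : connected d) (Hlpc : locally_path_connected d).

Lemma fundamental_group_dichotomy (x0 : X) :
  countable_quotient (is_loop d x0) (loop_homotopic d x0) \/
  continuum_quotient (is_loop d x0) (loop_homotopic d x0).
Proof.
  destruct Hsep as [pts Hpts].
  pose proof (hpt_congruence d Hm) as HR.
  destruct (countable_or_continuum_many d Hm Hsep Hconn Hlpc x0 (hpt_analytic d Hm pts Hpts Hcomplete))
    as [[F HF]|[u Hu]].
  - left. exists (fun n => restr (pf d (F n))). split; [intros n; apply loop_restr|].
    intros g Hg. destruct (restr_of_loop x0 g Hg) as [p ->]. destruct (HF p) as [n Hn].
    exists n. apply loop_homotopic_restr, Hn.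
  - right. apply (continuum_quotient_of_injections _ _ (fun a => restr (pf d (u a)))
      (fun g => path_code pts (fun t => g (clampI t)))).
    + intros g Hg. destruct (restr_of_loop x0 g Hg) as [p ->]. apply loop_homotopic_restr, hpt_ext. auto.
    + intros g h Hg Hh. destruct (restr_of_loop x0 g Hg) as [p ->], (restr_of_loop x0 h Hh) as [q ->].
      rewrite !loop_homotopic_restr. apply hpt_sym.
    + intros g h k Hg Hh Hk. destruct (restr_of_loop x0 g Hg) as [p ->], (restr_of_loop x0 h Hh) as [q ->],
        (restr_of_loop x0 k Hk) as [r ->].
      rewrite !loop_homotopic_restr. apply (hpt_trans d Hm).
    + intros a. apply loop_restr.
    + intros a b. rewrite loop_homotopic_restr. apply Hu.
    + intros g h Hg Hh E.
      assert (g = h) as <-.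
      { extensionality t. rewrite <- (clampI_proj t).
        apply (path_code_inj pts Hpts (fun t => g (clampI t)) (fun t => h (clampI t)));
          [apply cR_clampI, Hg|apply cR_clampI, Hh|exact E|apply (proj2_sig t)]. }
      destruct (restr_of_loop x0 g Hg) as [p ->]. apply loop_homotopic_restr, hpt_ext. auto.
Qed.

Lemma homology_dichotomy :
  countable_quotient (is_cycle d) (homologous d) \/ continuum_quotient (is_cycle d) (homologous d).
Proof.
  destruct Hsep as [pts Hpts]. destruct (proj1 Hconn) as [x0 _].
  pose proof (cycle_represented x0 (path_connected d Hm Hconn Hlpc x0)) as Hrep.
  destruct (countable_or_continuum_many d Hm (HR := hml_congruence d Hm) Hsep Hconn Hlpc x0
    (hml_analytic d Hm pts Hpts Hcomplete)) as [[F HF]|[u Hu]].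
  - left. exists (fun n => simplex d (F n)). split; [intros n; apply simplex_cycle|].
    intros c Hc. destruct (Hrep c Hc) as [g Hg]. destruct (HF g) as [n Hn]. exists n.
    eapply homologous_trans; [exact Hg|exact Hn].
  - right.
    (* Cycles are coded through a chosen loop in their class: the simplex of this loop, and with it
       the class, is determined by the code of the loop. *)
    assert (G : forall c, exists g : pth d x0 x0, is_cycle d c -> homologous d c (simplex d g)).
    { intros c. destruct (classic (is_cycle d c)) as [Hc|N].
      - destruct (Hrep c Hc) as [g Hg]. exists g. auto.
      - exists (cst d Hm x0). tauto. }
    apply functional_choice in G. destruct G as [g Hg].
    apply (continuum_quotient_of_injections _ _ (fun a => simplex d (u a)) (fun c => path_code pts (pf d (g c)))).
    + intros c _. apply homologous_refl.
    + intros c c' _ _. apply homologous_sym.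
    + intros c c' c'' _ _ _. apply homologous_trans.
    + intros a. apply simplex_cycle.
    + exact Hu.
    + intros c c' Hc Hc' E.
      assert (Es : simplex d (g c) = simplex d (g c')).
      { unfold simplex. erewrite restr_ext; [reflexivity|].
        apply (path_code_inj pts Hpts); [apply pth_cont..|exact E]. }
      eapply homologous_trans; [apply Hg, Hc|]. rewrite Es. apply homologous_sym, Hg, Hc'.
Qed.
End Quotients.

Theorem theorem4p3 (X : Type) (d : X -> X -> R)
  (Hmetric : is_metric d) (Hcomplete : complete d) (Hsep : separable d)
  (Hconn : connected d) (Hlpc : locally_path_connected d) :
  (forall x0 : X,
     countable_quotient (is_loop d x0) (loop_homotopic d x0) \/
     continuum_quotient (is_loop d x0) (loop_homotopic d x0)) /\
  (countable_quotient (is_cycle d) (homologous d) \/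
   continuum_quotient (is_cycle d) (homologous d)).
Proof.
  split; [intros x0; apply fundamental_group_dichotomy|apply homology_dichotomy]; assumption.
Qed.
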